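(* The Cauchy family is exactly invariant under the flow $\partial_{t}f=(2\sin^{2}(\pi F)-1)f$: the initial law $\mathrm{Cauchy}(m,\gamma)$ evolves at time $t$ to $\mathrm{Cauchy}(m,\gamma e^{-t})$, with reduced dynamics $\dot m=0$, $\dot\gamma=-\gamma$ and exact entropy law $H=\log(4\pi\gamma)$, $\dot H=-1$. The Fisher–Rao metric of the family is $$ds^{2}=\frac{dm^{2}+d\gamma^{2}}{2\gamma^{2}},$$ a hyperbolic plane of curvature $-2$, and the flow traces its vertical geodesics ($m$ constant) at constant speed $1/\sqrt2$.
   Context: $F(x,t)=\int_{-\infty}^{x}f(y,t)\,dy$ is the distribution function of $f(\cdot,t)$. $\mathrm{Cauchy}(m,\gamma)$, $m\in\mathbb{R}$, $\gamma>0$, has density $\frac{\gamma}{\pi[(x-m)^{2}+\gamma^{2}]}$. $H(f)=-\int f\log f$ is differential entropy. The Fisher–Rao metric of a parametric family is the Riemannian metric given by its Fisher information matrix. *)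

(* Defs.v *)
From HB Require Import structures.
From mathcomp Require Import all_boot all_order all_algebra.
From mathcomp Require Import all_classical all_reals all_analysis.

Set Implicit Arguments.
Unset Strict Implicit.
Unset Printing Implicit Defensive.

Import Order.TTheory GRing.Theory Num.Theory.
Import numFieldNormedType.Exports.

Local Open Scope classical_set_scope.
Local Open Scope ring_scope.

Section Densities.
Context {R : realType}.
Local Notation mu := (@lebesgue_measure R).

Definition is_density (f : R -> R) : Prop :=
  [/\ measurable_fun setT f, forall x, 0 <= f x &
      (\int[mu]_x (f x)%:E = 1)%E].

Definition cdf_of (f : R -> R) (x : R) : R := \int[mu]_(y in `]-oo, x]) f y.

(* Extended-real valued. As [+oo - +oo = -oo] in [\bar R], a finite value
   entails that [f * ln f] is integrable; [ln 0 = 0] gives the usual convention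
   [0 * ln 0 = 0]. *)
Definition entropy (f : R -> R) : \bar R :=
  (- \int[mu]_x (f x * ln (f x))%:E)%E.

Definition cauchy_density (m gamma x : R) : R :=
  gamma / (pi * ((x - m) ^+ 2 + gamma ^+ 2)).

(* Derivative relative to a set of times [J]: two-sided at interior points,
   one-sided at the endpoints of an interval. *)
Definition has_deriv_within (J : set R) (h : R -> R) (t l : R) : Prop :=
  (h s - h t) / (s - t) @[s --> within J t^'] --> l.

(* The time variable is the first argument of [f]. *)
Definition flow_solution (J : set R) (f : R -> R -> R) : Prop :=
  (forall t, J t -> is_density (f t)) /\
  (forall t x, J t ->
     has_deriv_within J (f ^~ x) t
       ((2 * sin (pi * cdf_of (f t) x) ^+ 2 - 1) * f t x)).

End Densities.

Section RiemannianGeometry.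
(* Riemannian geometry in a global chart: points and tangent vectors are row
   vectors, a metric is the field of its Gram matrices. *)
Context {R : realType} {n : nat}.
Local Notation V := 'rV[R]_n.+1.
Implicit Types (g : V -> 'M[R]_n.+1) (U : set V) (theta u v : V).

Definition pderiv (i : 'I_n.+1) (h : V -> R) (theta : V) : R :=
  'D_(delta_mx 0 i) h theta.

(* Differentiability of every iterated partial derivative, i.e. C^oo on an
   open [U]. *)
Definition smooth_on U (h : V -> R) : Prop :=
  forall (w : seq 'I_n.+1) theta, U theta ->
    differentiable (foldr pderiv h w) theta.

Definition inner g theta u v : R := (u *m g theta *m v^T) 0 0.

Definition riemannian_metric U g : Prop :=
  [/\ forall i j, smooth_on U (fun theta => g theta i j),
      forall theta, U theta -> (g theta)^T = g theta &
      forall theta v, U theta -> v != 0 -> 0 < inner g theta v v].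

(* $\Gamma^k_{ij}$ *)
Definition christoffel g (k i j : 'I_n.+1) theta : R :=
  2^-1 * \sum_l invmx (g theta) k l *
    (pderiv i (fun z => g z j l) theta + pderiv j (fun z => g z i l) theta
     - pderiv l (fun z => g z i j) theta).

(* The [l]-th component of $R(\partial_i,\partial_j)\partial_k$, where
   $R(X,Y)Z = \nabla_X\nabla_Y Z - \nabla_Y\nabla_X Z - \nabla_{[X,Y]} Z$. *)
Definition curvature_tensor g (l i j k : 'I_n.+1) theta : R :=
  pderiv i (christoffel g l j k) theta - pderiv j (christoffel g l i k) theta
  + \sum_s (christoffel g s j k theta * christoffel g l i s theta
            - christoffel g s i k theta * christoffel g l j s theta).

(* Affinely parametrized geodesic of [U], defined for all times. *)
Definition geodesic U g (c : R -> V) : Prop :=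
  [/\ forall t, U (c t),
      forall t, derivable c t 1 /\ derivable (derive1 c) t 1 &
      forall t k, derive1 (derive1 c) t 0 k
        + \sum_i \sum_j christoffel g k i j (c t)
                        * derive1 c t 0 i * derive1 c t 0 j = 0].

Definition geodesically_complete U g : Prop :=
  forall theta v, U theta ->
    exists c, [/\ geodesic U g c, c 0 = theta & derive1 c 0 = v].

Definition speed g (c : R -> V) (t : R) : R :=
  Num.sqrt (inner g (c t) (derive1 c t) (derive1 c t)).

End RiemannianGeometry.

Section FisherInformation.
Context {R : realType} {n : nat}.
Local Notation mu := (@lebesgue_measure R).
Local Notation V := 'rV[R]_n.+1.
Variable p : V -> R -> R.

Definition score (i : 'I_n.+1) (theta : V) (x : R) : R :=
  pderiv i (fun z => ln (p z x)) theta.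

(* The scores and the Fisher information at [theta] genuinely exist, rather
   than being default values of [derive] and [Rintegral]. *)
Definition fisher_regular (theta : V) : Prop :=
  (forall x, differentiable (fun z => ln (p z x)) theta) /\
  (forall i j, mu.-integrable setT
     (fun x => (score i theta x * score j theta x * p theta x)%:E)).

Definition fisher_metric (theta : V) : 'M[R]_n.+1 :=
  \matrix_(i, j)
    \int[mu]_x (score i theta x * score j theta x * p theta x).

End FisherInformation.

Section HalfPlane.
Context {R : realType}.

(* Coordinate 0 is $m$ and coordinate 1 is $\gamma$. *)
Definition half_plane : set 'rV[R]_2 := [set theta | 0 < theta 0 1].

Definition hp_point (m gamma : R) : 'rV[R]_2 :=
  \row_j (if j == 0 then m else gamma).

Definition cauchy_family (theta : 'rV[R]_2) : R -> R :=
  cauchy_density (theta 0 0) (theta 0 1).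

Definition gauss_curvature (g : 'rV[R]_2 -> 'M[R]_2) (theta : 'rV[R]_2) : R :=
  (\sum_l g theta 0 l * curvature_tensor g l 0 1 1 theta) / \det (g theta).

(* The hyperbolic plane of curvature [K < 0] is the complete simply connected
   surface of constant curvature [K]; the underlying surface is here the
   half-plane, which is convex and hence simply connected. *)
Definition hyperbolic_plane (K : R) (g : 'rV[R]_2 -> 'M[R]_2) : Prop :=
  [/\ K < 0, riemannian_metric half_plane g,
      geodesically_complete half_plane g &
      forall theta, half_plane theta -> gauss_curvature g theta = K].

End HalfPlane.

(* Main.v *)
Require Import Defs.
From HB Require Import structures.
From mathcomp Require Import all_boot all_order all_algebra.
From mathcomp Require Import all_classical all_reals all_analysis.
From mathcomp Require Import measurable_realfun ring lra.

(** Why the theorem holds.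

    The flow and its solution.  The distribution function of Cauchy(m, gamma)
    is 1/2 + th/pi with th = atan ((x - m) / gamma), so sin^2 (pi F) = cos^2 th
    and the growth rate 2 sin^2 (pi F) - 1 is the rational function
    (gamma^2 - y^2) / (gamma^2 + y^2) of y = x - m.  This is also the
    logarithmic derivative in time of the Cauchy density when gamma' = - gamma
    ([cauchy_flow_solution]).

    Uniqueness.  The equation is nonlocal, but its rate lies in [-1, 1] and is
    2 pi-Lipschitz in F.  For t >= 0 a solution f is thus dominated by e^t f(0, .)
    ([segment_flow_growth]), and a pointwise bound |f - g| <= A e^(lam t) f(0, .)
    between two solutions integrates in x to |F - G| <= A e^(lam t), because
    f(0, .) is a density.  Put back into the equation, this reproduces the bound
    with A / 2 as soon as lam is large ([segment_flow_unique]); hence f = g.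
    Only mean value inequalities in t, for each fixed x, are needed.  Backward
    times are handled by reversing the sign of the rate.  The reduced dynamics
    follow by restarting the solution at each time and from the identifiability
    of (m, gamma) ([cauchy_density_inj]).

    Entropy.  Everything reduces to the expectation of ln (1 + u^2) for
    u = (x - m) / gamma.  Writing ln (1 + u^2) as the integral over s in (0, 1)
    of 2 s u^2 / (1 + s^2 u^2) and exchanging the two integrals, the integral in
    x becomes a combination of the total masses of two Cauchy laws, equal to
    2 / (1 + s), and the integral of the latter is ln 4 ([cauchy_integral_ln]).

    Fisher metric.  Under Cauchy(m, gamma) the angle th is uniform on
    (-pi/2, pi/2) ([cauchy_angle_integral]), and the scores in m and gamma are
    sin (2 th) / gamma and - cos (2 th) / gamma ([score_m], [score_gamma]).  Two
    orthogonal functions of mean square 1/2 give the matrix 1 / (2 gamma^2)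
    times the identity.

    Geometry.  The metric coefficients, the Christoffel symbols and all their
    derivatives are constant multiples of powers of gamma on the half-plane, so
    smoothness and the curvature are algebra ([pderiv_gamma_power]).  The
    geodesics, for all times and all initial data, are given by the single
    formula gamma = g0 / D, m = m0 + g0 al S / D with S = sinh (om t) and
    D = cosh (om t) - be sinh (om t), al^2 + be^2 = 1 ([hp_geodesic]): this is
    completeness, and al = 0, be = -1, om = 1 is the curve traced by the
    flow. *)

Set Implicit Arguments.
Unset Strict Implicit.
Unset Printing Implicit Defensive.

Import Order.TTheory GRing.Theory Num.Theory.
Import numFieldNormedType.Exports.

Local Open Scope classical_set_scope.
Local Open Scope ring_scope.

(** * Integration over the real line *)

Section line_integration.
Context {R : realType}.
Local Notation mu := (@lebesgue_measure R).

Lemma is_derive_continuous (F f : R -> R) :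
  (forall x : R, is_derive x 1 F (f x)) -> continuous F.
Proof.
by move=> dF x; apply/differentiable_continuous/derivable1_diffP/ex_derive.
Qed.

(** The theorem on a half-line unbounded to the right, reflected. *)
Lemma ge0_FTC2Ny (f F : R -> R) (b l : R) :
  (forall x, 0 <= f x) -> continuous f ->
  (forall x : R, is_derive x 1 F (f x)) -> F x @[x --> -oo] --> l ->
  (\int[mu]_(x in `]-oo, b]) (f x)%:E = (F b - l)%:E)%E.
Proof.
move=> f0 cf dF Fl.
rewrite -[b]opprK ge0_integration_by_substitutionNy; last 2 first.
- exact: continuous_subspaceT.
- by move=> x _; exact: f0.
have dG (x : R) : is_derive x 1 (fun y => - F (- y)) (f (- x)).
  have := dF (- x) => ?.
  by apply: is_derive_eq; rewrite !mulrN1 opprK.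
rewrite (@ge0_continuous_FTC2y _ _ (fun y => - F (- y)) _ (- l)) //.
- by rewrite !opprK -EFinB opprK addrC.
- by move=> x _; exact: f0.
- apply: continuous_subspaceT => x.
  by apply: continuous_comp; [exact: opp_continuous|exact: cf].
- by apply: cvgN; have /cvgNy_compNP := Fl.
- exact/cvg_at_right_filter/(is_derive_continuous dG).
- by move=> x _; rewrite derive1E; exact: derive_val.
Qed.

Lemma ge0_FTC2T (f F : R -> R) (l L : R) :
  (forall x, 0 <= f x) -> continuous f ->
  (forall x : R, is_derive x 1 F (f x)) ->
  F x @[x --> -oo] --> l -> F x @[x --> +oo] --> L ->
  (\int[mu]_x (f x)%:E = (L - l)%:E)%E.
Proof.
move=> f0 cf dF Fl FL.
have mf : measurable_fun [set: R] f by exact: continuous_measurable_fun.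
have -> : [set: R] = `]-oo, 0] `|` `]0, +oo[.
  by rewrite -itv_bndbnd_setU// ; apply/seteqP; split => x //=; rewrite in_itv.
rewrite ge0_integral_setU//; last 3 first.
- by apply/measurable_EFinP; exact: measurable_funTS.
- by move=> x _; rewrite lee_fin.
- apply/disj_setPS => x [] /=; rewrite !in_itv/= andbT => x0 /(le_lt_trans x0).
  by rewrite ltxx.
rewrite (ge0_FTC2Ny _ f0 cf dF Fl).
rewrite integral_itv_obnd_cbnd; last by apply/measurable_EFinP; exact: measurable_funTS.
rewrite (@ge0_continuous_FTC2y _ _ F _ L) //.
- by rewrite -EFinB -EFinD; congr EFin; ring.
- exact: continuous_subspaceT.
- exact/cvg_at_right_filter/(is_derive_continuous dF).
- by move=> x _; rewrite derive1E; exact: derive_val.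
Qed.

(** The fundamental theorem on the whole line for an integrand of variable sign
    dominated by some [h] with a known primitive: [g + h] and [h] are both
    nonnegative, and the integral of [g] is the difference of theirs. *)
Section dominated.
Variables (h H g G : R -> R) (k K l L : R).
Hypotheses (ch : continuous h) (dH : forall x : R, is_derive x 1 H (h x))
  (Hk : H x @[x --> -oo] --> k) (HK : H x @[x --> +oo] --> K)
  (cg : continuous g) (dG : forall x : R, is_derive x 1 G (g x))
  (Gl : G x @[x --> -oo] --> l) (GL : G x @[x --> +oo] --> L)
  (gh : forall x, `|g x| <= h x).

Let h0 x : 0 <= h x. Proof. exact: le_trans (gh x). Qed.

Let ih : mu.-integrable setT (EFin \o h).
Proof.
apply/integrableP; split.
  by apply/measurable_EFinP; exact: continuous_measurable_fun.
under eq_integral do rewrite /= ger0_norm//.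
by rewrite (ge0_FTC2T h0 ch dH Hk HK) ltry.
Qed.

Lemma dominated_integrable : mu.-integrable setT (EFin \o g).
Proof.
apply: le_integrable ih => //.
  by apply/measurable_EFinP; exact: continuous_measurable_fun.
by move=> x _; rewrite /= lee_fin (ger0_norm (h0 x)).
Qed.

Lemma dominated_FTC2T : \int[mu]_x g x = L - l.
Proof.
have gE : g = (fun x => (g x + h x) - h x) by apply/funext => x; rewrite addrK.
have ghi : mu.-integrable setT (EFin \o (fun x => g x + h x)).
  exact: integrableD dominated_integrable ih.
rewrite [in LHS]gE RintegralB// /Rintegral.
rewrite (ge0_FTC2T h0 ch dH Hk HK).
have -> : (\int[mu]_x (g x + h x)%:E = (L + K - (l + k))%:E)%E.
  apply: (@ge0_FTC2T _ (fun x => G x + H x)) => [x|x||].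
  - by have := gh x; rewrite ler_norml => /andP[]; lra.
  - by apply: cvgD; [exact: cg|exact: ch].
  - exact: cvgD.
  - exact: cvgD.
by rewrite /=; ring.
Qed.

End dominated.

End line_integration.

(** * The Cauchy law *)

Section cauchy_law.
Context {R : realType}.
Local Notation mu := (@lebesgue_measure R).

Section cauchy_cdf.
Variables (m gamma : R).
Hypothesis gamma_gt0 : 0 < gamma.
Let f := cauchy_density m gamma.

Lemma cauchy_den_gt0 x : 0 < (x - m) ^+ 2 + gamma ^+ 2.
Proof. by rewrite ltr_wpDl ?sqr_ge0// exprn_gt0. Qed.

Lemma cauchy_density_gt0 x : 0 < f x.
Proof. by rewrite divr_gt0// mulr_gt0 ?pi_gt0// cauchy_den_gt0. Qed.

Lemma continuous_cauchy_density : continuous f.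
Proof.
move=> x; rewrite /f /cauchy_density.
apply: differentiable_continuous; apply/derivable1_diffP.
have ? : pi * ((x - m) ^+ 2 + gamma ^+ 2) != 0.
  by rewrite mulf_neq0 ?gt_eqF ?pi_gt0 ?cauchy_den_gt0.
exact: ex_derive.
Qed.

(** The primitive of the density normalised to vanish at [-oo]; at [+oo] it tends
    to 1, which is the total mass. *)
Lemma is_derive_cauchy_cdf (x : R) :
  is_derive x 1 (fun y => 2^-1 + atan ((y - m) / gamma) / pi) (f x).
Proof.
apply: is_derive_eq; rewrite /f /cauchy_density /GRing.scale/=.
have := cauchy_den_gt0 x; have := pi_gt0 R.
move: (pi : R) => p p0 q0; field.
by rewrite !gt_eqF.
Qed.

Lemma cvgy_atan_affine : (atan ((x - m) / gamma) : R) @[x --> +oo] --> (pi / 2 : R).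
Proof.
apply: (@cvg_comp _ _ _ (fun x => (x - m) / gamma) atan _ +oo); last exact: cvgy_atan.
by apply: gt0_cvgMly; [rewrite invr_gt0|exact: cvg_addrr].
Qed.

Lemma cvgNy_atan_affine :
  (atan ((x - m) / gamma) : R) @[x --> -oo] --> (- (pi / 2) : R).
Proof.
apply: (@cvg_comp _ _ _ (fun x => (x - m) / gamma) atan _ -oo).
  by apply: gt0_cvgMlNy; [rewrite invr_gt0|exact: cvg_addrr_Ny].
apply/cvgNy_compNP; rewrite /comp.
under eq_fun do rewrite atanN.
by apply: cvgN; exact: cvgy_atan.
Qed.

Lemma cauchy_cdf_cvgy :
  (2^-1 + atan ((x - m) / gamma) / pi : R) @[x --> +oo] --> (1 : R).
Proof.
have e : 2^-1 + pi / 2 / pi = 1 :> R.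
  by have := pi_gt0 R; move: (pi : R) => p p0; field; rewrite gt_eqF.
by rewrite -[X in _ --> X]e; apply: cvgD; [exact: cvg_cst|exact: cvgMr_tmp cvgy_atan_affine].
Qed.

Lemma cauchy_cdf_cvgNy :
  (2^-1 + atan ((x - m) / gamma) / pi : R) @[x --> -oo] --> (0 : R).
Proof.
have e : 2^-1 + - (pi / 2) / pi = 0 :> R.
  by have := pi_gt0 R; move: (pi : R) => p p0; field; rewrite gt_eqF.
by rewrite -[X in _ --> X]e; apply: cvgD; [exact: cvg_cst|exact: cvgMr_tmp cvgNy_atan_affine].
Qed.

Lemma cauchy_cdf x : cdf_of f x = 2^-1 + atan ((x - m) / gamma) / pi.
Proof.
rewrite /cdf_of /Rintegral.
have f0 y : 0 <= f y by exact/ltW/cauchy_density_gt0.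
by rewrite (ge0_FTC2Ny _ f0 continuous_cauchy_density is_derive_cauchy_cdf
  cauchy_cdf_cvgNy) /= subr0.
Qed.

Lemma measurable_cauchy_density : measurable_fun setT f.
Proof.
by apply: continuous_measurable_fun; exact: continuous_cauchy_density.
Qed.

Lemma cauchy_is_density : is_density f.
Proof.
have f0 y : 0 <= f y by exact/ltW/cauchy_density_gt0.
split => //; first exact: measurable_cauchy_density.
by rewrite (ge0_FTC2T f0 continuous_cauchy_density is_derive_cauchy_cdf
  cauchy_cdf_cvgNy cauchy_cdf_cvgy) subr0.
Qed.

End cauchy_cdf.

Lemma density_integrable (f : R -> R) (D : set R) : measurable D ->
  is_density f -> mu.-integrable D (EFin \o f).
Proof.
move=> mD [mf f0 f1].
apply: (@integrableS _ _ _ mu setT) => //.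
apply/integrableP; split; first exact/measurable_EFinP.
under eq_integral do rewrite /= ger0_norm//.
by rewrite f1 ltry.
Qed.

End cauchy_law.

(** * Derivatives relative to a set of times *)

Section derivatives_within.
Context {R : realType}.

Implicit Types (J : set R) (h k : R -> R).

(** Both notions of derivative are continuity at [t] of the difference quotient
    completed by [l] (Caratheodory's criterion). *)
Lemma has_deriv_within_interior J h (t l : R) : (\forall s \near t, J s) ->
  has_deriv_within J h t l -> is_derive t 1 h l.
Proof.
move=> Jt ht; apply/is_derive1_caratheodory.
exists (fun s => if s == t then l else (h s - h t) / (s - t)); split.
- move=> z; case: eqP => [->|/eqP]; first by rewrite !subrr mulr0.
  by rewrite -subr_eq0 => /divfK->.
- apply/continuous_withinNx; rewrite eqxx => P /ht HP.
  have {}HP : \forall s \near t^', J s -> P ((h s - h t) / (s - t)) by exact: HP.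
  have {}Jt : \forall s \near t^', J s by exact: nbhs_dnbhs.
  have tt := nbhs_dnbhs_neq t.
  move: HP; apply: filter_app; move: Jt; apply: filter_app; move: tt; apply: filter_app.
  by apply: nearW => s st _ Js H /=; rewrite (negPf st); exact: H.
- by rewrite eqxx.
Unshelve. all: by end_near. Qed.

Lemma is_derive_within J h (t l : R) :
  is_derive t 1 h l -> has_deriv_within J h t l.
Proof.
move=> /is_derive1_caratheodory[g [hE cg <-]].
move/continuous_withinNx : cg => cg P /cg HP.
have {}HP : \forall s \near t^', P (g s) by exact: HP.
suff : \forall s \near t^', J s -> P ((h s - h t) / (s - t)) by [].
move: HP; apply: filter_app; have := nbhs_dnbhs_neq t; apply: filter_app.
by apply: nearW => s st _ Ps _ /=; rewrite hE mulfK// subr_eq0.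
Qed.

Lemma has_deriv_within_eq J h k (t l : R) : J t -> (forall s, J s -> h s = k s) ->
  has_deriv_within J h t l -> has_deriv_within J k t l.
Proof.
move=> Jt hk ht P /ht HP.
have {}HP : \forall s \near t^', J s -> P ((h s - h t) / (s - t)) by exact: HP.
suff : \forall s \near t^', J s -> P ((k s - k t) / (s - t)) by [].
by move: HP; apply: filterS => s /= HP Js; rewrite -!hk//; exact: HP.
Qed.

Lemma has_deriv_within_cvg J h (t l : R) : has_deriv_within J h t l ->
  h s @[s --> within J t^'] --> h t.
Proof.
move=> ht.
have dt : (s - t) @[s --> within J t^'] --> (t - t).
  have ct : (s - t) @[s --> t] --> t - t by apply: cvgB; [exact: cvg_id|exact: cvg_cst].
  move=> P /ct HP.
  suff : \forall s \near t^', J s -> P (s - t) by [].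
  apply: nbhs_dnbhs; have {}HP : \forall s \near t, P (s - t) by exact: HP.
  by apply: filterS HP => s Ps _.
have := cvgD (cvg_cst (h t)) (cvgM ht dt).
rewrite subrr mulr0 addr0 => dh P /dh HP.
have {}HP : \forall s \near t^', J s -> P (h t + (h s - h t) / (s - t) * (s - t)).
  exact: HP.
suff : \forall s \near t^', J s -> P (h s) by [].
move: HP; apply: filter_app; have := nbhs_dnbhs_neq t; apply: filter_app.
apply: nearW => s st _; rewrite divfK ?subr_eq0// addrC subrK; exact.
Qed.

(** With [e = 1] this restarts time at [a]; with [e = - 1] it also reverses it. *)
Lemma has_deriv_within_affine J h (a e s l : R) : e != 0 ->
  has_deriv_within J h (a + e * s) l ->
  has_deriv_within [set s | J (a + e * s)] (fun s => h (a + e * s)) s (e * l).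
Proof.
move=> e0 ht; rewrite /has_deriv_within.
have phi : (a + e * z) @[z --> within [set s | J (a + e * s)] s^'] -->
    within J (a + e * s)^'.
  move=> P HP.
  have {}HP : \forall y \near a + e * s, y != a + e * s -> J y -> P y by exact: HP.
  have cphi : (a + e * z) @[z --> s] --> a + e * s.
    exact: cvgD (cvg_cst a) (cvgM (cvg_cst e) cvg_id).
  have {}HP : \forall z \near s,
      a + e * z != a + e * s -> J (a + e * z) -> P (a + e * z) by exact: cphi HP.
  suff : \forall z \near s, z != s -> J (a + e * z) -> P (a + e * z) by [].
  apply: filterS HP => z Hz zs; apply: Hz.
  by rewrite (inj_eq (addrI a)) (inj_eq (mulfI e0)).
have {}ht := cvgM (cvg_cst e) (cvg_comp _ _ phi ht).
move=> P /ht HP.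
have {}HP : \forall z \near s^', J (a + e * z) ->
    P (e * ((h (a + e * z) - h (a + e * s)) / (a + e * z - (a + e * s)))).
  exact: HP.
suff : \forall z \near s^', J (a + e * z) ->
    P ((h (a + e * z) - h (a + e * s)) / (z - s)) by [].
move: HP; apply: filter_app; have := nbhs_dnbhs_neq s; apply: filter_app.
apply: nearW => z st _ HP /HP; congr (P _).
have zs : z - s != 0 by rewrite subr_eq0.
have -> : a + e * z - (a + e * s) = e * (z - s) by ring.
by field; rewrite e0 zs.
Qed.

(** On a segment of times contained in [J], derivatives relative to [J] give the
    hypotheses of the mean value theorem: two-sided derivatives inside, continuity
    up to the endpoints. *)
Section segment.
Variables (J : set R) (h dh : R -> R) (a b : R).
Hypotheses (ab : a < b) (abJ : `[a, b] `<=` J)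
  (hdh : forall s, s \in `[a, b] -> has_deriv_within J h s (dh s)).

Lemma segment_is_derive s : s \in `]a, b[ -> is_derive s 1 h (dh s).
Proof.
move=> sab; apply: (@has_deriv_within_interior J); last by apply: hdh; exact: subset_itv_oo_cc.
have : \forall z \near s, z \in `]a, b[.
  exact: near_in_itvoo.
by apply: filterS => z zab; apply: abJ; exact: subset_itv_oo_cc.
Qed.

Lemma segment_continuous : {within `[a, b], continuous h}.
Proof.
apply/continuous_within_itvP => //; split.
- move=> s /segment_is_derive hs.
  exact/differentiable_continuous/derivable1_diffP/ex_derive.
- have aab : a \in `[a, b] by rewrite in_itv/= lexx ltW.
  have hc := has_deriv_within_cvg (hdh aab).
  move=> P /hc HP.
  have {}HP : \forall s \near a, s != a -> J s -> P (h s) by exact: HP.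
  suff : \forall s \near a, a < s -> P (h s) by [].
  move: HP; apply: filter_app; near=> s => HP sa; apply: HP; first by rewrite gt_eqF.
  by apply: abJ; rewrite /= in_itv/= (ltW sa)/= ltW//; near: s; exact: lt_nbhsl.
- have bab : b \in `[a, b] by rewrite in_itv/= lexx ltW.
  have hc := has_deriv_within_cvg (hdh bab).
  move=> P /hc HP.
  have {}HP : \forall s \near b, s != b -> J s -> P (h s) by exact: HP.
  suff : \forall s \near b, s < b -> P (h s) by [].
  move: HP; apply: filter_app; near=> s => HP sb; apply: HP; first by rewrite lt_eqF.
  by apply: abJ; rewrite /= in_itv/= (ltW sb) andbT ltW//; near: s; exact: lt_nbhsr.
Unshelve. all: by end_near. Qed.

End segment.

Lemma derive_le_comparison (w q dw dq : R -> R) (a b : R) : a <= b ->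
  (forall s, s \in `]a, b[ -> is_derive s 1 w (dw s)) ->
  (forall s, s \in `]a, b[ -> is_derive s 1 q (dq s)) ->
  {within `[a, b], continuous w} -> {within `[a, b], continuous q} ->
  (forall s, s \in `]a, b[ -> dw s <= dq s) ->
  w b - w a <= q b - q a.
Proof.
rewrite le_eqVlt => /predU1P[->|ab]; first by rewrite !subrr.
move=> dwE dqE cw cq dwq.
have dwqE s : s \in `]a, b[ -> is_derive s 1 (fun z => q z - w z) (dq s - dw s).
  by move=> sab; have := dwE s sab => ?; have := dqE s sab => ?; exact: is_deriveB.
have cwq : {within `[a, b], continuous (fun z => q z - w z)}.
  by move=> z; apply: cvgB; [exact: cq|exact: cw].
have [c cab e] := MVT ab dwqE cwq.
rewrite -subr_ge0.
have -> : q b - q a - (w b - w a) = q b - w b - (q a - w a) by ring.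
by rewrite e mulr_ge0// subr_ge0 ?dwq// ltW.
Qed.

Lemma norm_derive_le_comparison (w q dw dq : R -> R) (a b : R) : a <= b ->
  (forall s, s \in `]a, b[ -> is_derive s 1 w (dw s)) ->
  (forall s, s \in `]a, b[ -> is_derive s 1 q (dq s)) ->
  {within `[a, b], continuous w} -> {within `[a, b], continuous q} ->
  (forall s, s \in `]a, b[ -> `|dw s| <= dq s) ->
  `|w b - w a| <= q b - q a.
Proof.
move=> ab dwE dqE cw cq dwq.
have dNwE s : s \in `]a, b[ -> is_derive s 1 (\- w) (- dw s).
  by move=> /dwE ?; exact: is_deriveN.
have cNw : {within `[a, b], continuous (\- w)} by move=> z; exact: (cvgN (cw z)).
rewrite ler_norml lerNl opprB; apply/andP; split; last first.
  by apply: (derive_le_comparison ab dwE dqE cw cq) => s /dwq; rewrite ler_norml => /andP[].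
have -> : w a - w b = (\- w) b - (\- w) a by rewrite /= opprK addrC.
apply: (derive_le_comparison ab dNwE dqE cNw cq) => s /dwq.
by rewrite ler_norml lerNl => /andP[].
Qed.

Lemma has_deriv_withinM J (h k : R -> R) (t a b : R) :
  has_deriv_within J h t a -> has_deriv_within J k t b ->
  has_deriv_within J (fun s => h s * k s) t (a * k t + h t * b).
Proof.
move=> dh dk.
have := cvgD (cvgM dh (has_deriv_within_cvg dk)) (cvgM (cvg_cst (h t)) dk).
move=> D P /D HP.
have {}HP : \forall s \near t^', J s ->
    P ((h s - h t) / (s - t) * k s + h t * ((k s - k t) / (s - t))) by exact: HP.
suff : \forall s \near t^', J s -> P ((h s * k s - h t * k t) / (s - t)) by [].
apply: filterS HP => s HP /HP; congr (P _).
by ring.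
Qed.

(** The interval hypothesis puts the whole segment between two times of [J]
    inside [J], where the mean value theorem applies. *)
Lemma has_deriv_within0_cst J (h : R -> R) : is_interval J ->
  (forall t, J t -> has_deriv_within J h t 0) ->
  forall a b, J a -> J b -> h a = h b.
Proof.
move=> iJ dh a b; wlog ab : a b / a < b.
  by move=> H Ja Jb; case: (ltgtP a b) => [/H|/H|->//] e; rewrite e.
move=> Ja Jb.
have sJ : `[a, b] `<=` J by move=> z; rewrite /= in_itv/=; exact: iJ.
have dh' s : s \in `[a, b] -> has_deriv_within J h s 0 by move=> /sJ; exact: dh.
have [c _] := MVT ab (segment_is_derive sJ dh') (segment_continuous ab sJ dh').
by rewrite mul0r => /eqP; rewrite subr_eq0 => /eqP.
Qed.

End derivatives_within.

(** * Uniqueness for the flow *)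

Section flow_uniqueness.
Context {R : realType}.
Implicit Types (J : set R).
Local Notation mu := (@lebesgue_measure R).

Lemma sin_sqr_rate_bound (a : R) : `|2 * sin a ^+ 2 - 1| <= 1.
Proof.
have := sqr_ge0 (sin a); have := sqr_ge0 (cos a); rewrite cos2sin2.
by rewrite ler_norml => ? ?; apply/andP; split; nra.
Qed.

(** The derivative is [4 sin cos = 2 sin (2 s)]. *)
Lemma sin_sqr_rate_lipschitz (a b : R) :
  `|(2 * sin a ^+ 2 - 1) - (2 * sin b ^+ 2 - 1)| <= 2 * `|a - b|.
Proof.
wlog ba : a b / b <= a.
  by move=> H; case: (leP b a) => [|/ltW] /H //; rewrite distrC (distrC a).
have dw (s : R) : is_derive s 1 (fun x => 2 * sin x ^+ 2 - 1) (4 * sin s * cos s).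
  by apply: is_derive_eq; rewrite /GRing.scale/=; ring.
have dq (s : R) : is_derive s 1 (fun x => 2 * x) (2 : R).
  by apply: is_derive_eq; rewrite /GRing.scale/= mulr1.
have cts (h dh : R -> R) : (forall s : R, is_derive s 1 h (dh s)) -> {within `[b, a], continuous h}.
  by move=> dh'; apply: continuous_subspaceT; exact: is_derive_continuous dh'.
have sin2 (s : R) : - 2 <= 4 * sin s * cos s <= 2.
  have := cos2Dsin2 s; have := sqr_ge0 (cos s + sin s); have := sqr_ge0 (cos s - sin s).
  by move: (cos s) (sin s) => c d *; apply/andP; split; nra.
rewrite (@ger0_norm _ (a - b)) ?subr_ge0// mulrBr.
apply: (norm_derive_le_comparison ba (fun s _ => dw s) (fun s _ => dq s) (cts _ _ dw) (cts _ _ dq)).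
by move=> s _; rewrite ler_norml sin2.
Qed.

(** The rate is bounded by 1 and 2-Lipschitz in the angle [pi F]; this splits the
    difference of two right-hand sides into a local and a nonlocal part. *)
Lemma flow_rate_lipschitz (a b u v : R) : 0 <= v ->
  `|(2 * sin a ^+ 2 - 1) * u - (2 * sin b ^+ 2 - 1) * v| <=
    `|u - v| + 2 * `|a - b| * v.
Proof.
move=> v0.
have -> : (2 * sin a ^+ 2 - 1) * u - (2 * sin b ^+ 2 - 1) * v =
  (2 * sin a ^+ 2 - 1) * (u - v) +
  ((2 * sin a ^+ 2 - 1) - (2 * sin b ^+ 2 - 1)) * v by ring.
apply: (le_trans (ler_normD _ _)); rewrite !normrM (ger0_norm v0); apply: lerD.
  by rewrite ler_piMl// sin_sqr_rate_bound.
by rewrite ler_wpM2r// sin_sqr_rate_lipschitz.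
Qed.

(** The flow on a time segment, run forward in time for [sg = 1] and backward for
    [sg = - 1], with the derivatives in the form used by the mean value theorem. *)
Definition segment_flow (sg T : R) (f : R -> R -> R) : Prop :=
  [/\ forall s, s \in `[0, T] -> is_density (f s),
      forall x s, s \in `]0, T[ ->
        is_derive s 1 (f ^~ x)
          (sg * ((2 * sin (pi * cdf_of (f s) x) ^+ 2 - 1) * f s x)) &
      forall x, {within `[0, T], continuous (f ^~ x)}].

Section uniqueness.
Variables (sg T : R).
Hypothesis sg1 : `|sg| = 1.

(** The rate being at most 1, [f s x * e^-s] is nonincreasing; nonnegativity of
    [f] is what makes the bound on the rate a bound on the derivative. *)
Lemma segment_flow_growth f s x : segment_flow sg T f -> s \in `[0, T] ->
  f s x <= expR s * f 0 x.
Proof.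
move=> [df dtf cf] sT; have := sT; rewrite in_itv/= => /andP[s0 sTle].
pose w z := f z x * expR (- z).
have sub z : z \in `]0, s[ -> z \in `]0, T[.
  by rewrite !in_itv/= => /andP[-> /lt_le_trans]; apply.
pose dw z := (sg * (2 * sin (pi * cdf_of (f z) x) ^+ 2 - 1) - 1) * f z x * expR (- z).
have dwE z : z \in `]0, s[ -> is_derive z 1 w (dw z).
  move=> /sub /(dtf x) ?; apply: is_derive_eq.
  by rewrite /GRing.scale/= /dw; ring.
have cw : {within `[0, s], continuous w}.
  have cfs : {within `[0, s], continuous (f ^~ x)}.
    by apply: continuous_subspaceW (cf x); apply: subset_itvl; rewrite bnd_simp.
  have ce : {within `[0, s], continuous (fun z => expR (- z))}.
    apply: continuous_subspaceT; apply: (@is_derive_continuous _ _ (fun z => - expR (- z))) => z.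
    by apply: is_derive_eq; rewrite mulrN1.
  by move=> z; exact: (cvgM (cfs z) (ce z)).
suff : w s - w 0 <= 0 - 0.
  rewrite subrr subr_le0 /w oppr0 expR0 mulr1 expRN.
  by rewrite ler_pdivrMr ?expR_gt0// mulrC.
have d0 (z : R) : z \in `]0, s[ -> is_derive z 1 (cst (0 : R)) 0.
  by move=> _; exact: is_derive_cst.
have c0 : {within `[0, s], continuous (cst (0 : R))}.
  by apply: continuous_subspaceT => z; exact: cst_continuous.
apply: (derive_le_comparison s0 dwE d0 cw c0).
move=> z /sub zT; rewrite /dw.
have [_ f0 _] := df z (subset_itv_oo_cc zT).
have : `|sg * (2 * sin (pi * cdf_of (f z) x) ^+ 2 - 1)| <= 1.
  by rewrite normrM sg1 mul1r sin_sqr_rate_bound.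
rewrite ler_norml => /andP[_ h].
by rewrite mulr_le0_ge0 ?expR_ge0// mulr_le0_ge0// subr_le0.
Qed.

(** Integrating a pointwise bound proportional to a density [c] of mass 1 loses
    the factor [c]: this turns the nonlocal term of the flow into a scalar. *)
Lemma cdf_diff_le (u v c : R -> R) (K x : R) :
  is_density u -> is_density v -> is_density c -> 0 <= K ->
  (forall y, `|u y - v y| <= K * c y) -> `|cdf_of u x - cdf_of v x| <= K.
Proof.
move=> du dv dc K0 uv.
have mD : measurable (`]-oo, x]%classic : set (measurableTypeR R)).
  exact: measurable_itv.
have iu := density_integrable mD du; have iv := density_integrable mD dv.
have ic := density_integrable mD dc.
have iKc : mu.-integrable `]-oo, x] (EFin \o (fun y => K * c y)).
  exact: (integrableZl _ K ic).
rewrite /cdf_of -RintegralB//.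
have iuv : mu.-integrable `]-oo, x] (EFin \o (fun y => u y - v y)).
  by have := integrableB mD iu iv; apply: eq_integrable => // y _; rewrite /= EFinB.
apply: (le_trans (le_normr_Rintegral mD iuv)).
apply: (@le_trans _ _ (\int[mu]_(y in `]-oo, x]) (K * c y))).
  apply: le_Rintegral => //.
  exact: (integrable_norm iuv).
rewrite RintegralZl// ler_piMr//.
have [mc c0 c1] := dc.
rewrite -lee_fin /Rintegral fineK; last exact: integrable_fin_num.
rewrite -c1; apply: ge0_subset_integral => //.
- exact/measurable_EFinP.
- by move=> y _; rewrite lee_fin.
Qed.

(** A contraction for the weighted norm
    [sup_(s, x) |f s x - g s x| / (e^(lam s) f 0 x)]: the derivative of [f - g] is
    at most [C] times the weighted bound, and integrating [e^(lam s)] gains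
    [1 / lam], so [lam = 2 C] halves it.  The norm is finite by the growth bound. *)
Lemma segment_flow_unique f g : 0 < T -> segment_flow sg T f -> segment_flow sg T g ->
  f 0 = g 0 -> forall s, s \in `[0, T] -> f s = g s.
Proof.
move=> T0 sf sg_ fg0; have [df dtf cf] := sf; have [dg dtg cg] := sg_.
have oT : 0 \in `[0, T] by rewrite in_itv/= lexx ltW.
have dc := df 0 oT.
(* [1] comes from the local part of the difference of the rates, and
   [2 pi e^T] from the Lipschitz constant in [F] times the growth of [g]. *)
pose C := 1 + 2 * pi * expR T; pose lam := 2 * C.
have C1 : 1 <= C by rewrite lerDl mulr_ge0 ?expR_ge0// mulr_ge0// pi_ge0.
have contraction A : 0 <= A ->
  (forall s x, s \in `[0, T] -> `|f s x - g s x| <= A * expR (lam * s) * f 0 x) ->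
  (forall s x, s \in `[0, T] -> `|f s x - g s x| <= A / 2 * expR (lam * s) * f 0 x).
  move=> A0 fgA s x sT; have [_ c0 _] := dc.
  pose w z := f z x - g z x.
  pose dw z := sg * ((2 * sin (pi * cdf_of (f z) x) ^+ 2 - 1) * f z x -
                    (2 * sin (pi * cdf_of (g z) x) ^+ 2 - 1) * g z x).
  pose q z := A / 2 * expR (lam * z) * f 0 x.
  pose dq z := C * (A * expR (lam * z) * f 0 x).
  have s0 : 0 <= s by move: sT; rewrite in_itv/= => /andP[].
  have sub z : z \in `]0, s[ -> z \in `]0, T[.
    move: sT; rewrite !in_itv/= => /andP[_ sT] /andP[-> /lt_le_trans]; exact.
  have dwE z : z \in `]0, s[ -> is_derive z 1 w (dw z).
    move=> /sub zT; have ? := dtf x z zT; have ? := dtg x z zT.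
    by apply: is_derive_eq; rewrite /dw mulrBr.
  have dqE z : z \in `]0, s[ -> is_derive z 1 q (dq z).
    move=> _; apply: is_derive_eq; rewrite /GRing.scale/= /dq /lam.
    by field.
  have cw : {within `[0, s], continuous w}.
    have cs (h : R -> R -> R) : {within `[0, T], continuous (h ^~ x)} ->
        {within `[0, s], continuous (h ^~ x)}.
      apply: continuous_subspaceW; apply: subset_itvl; rewrite bnd_simp.
      by move: sT; rewrite in_itv/= => /andP[].
    by move=> z; exact: (cvgB (cs f (cf x) z) (cs g (cg x) z)).
  have cq : {within `[0, s], continuous q}.
    apply: continuous_subspaceT; apply: (@is_derive_continuous _ _ dq) => z.
    apply: is_derive_eq; rewrite /GRing.scale/= /dq /lam.
    by field.
  have dwq z : z \in `]0, s[ -> `|dw z| <= dq z.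
    move=> /sub zT; have {}zT := subset_itv_oo_cc zT.
    rewrite normrM sg1 mul1r.
    have [_ gz0 _] := dg z zT.
    apply: (le_trans (flow_rate_lipschitz _ _ _ (gz0 x))).
    have zleT : z <= T by move: zT; rewrite in_itv/= => /andP[].
    have cdfK : `|cdf_of (f z) x - cdf_of (g z) x| <= A * expR (lam * z).
      apply: (cdf_diff_le x (df z zT) (dg z zT) dc); first by rewrite mulr_ge0 ?expR_ge0.
      by move=> y; exact: fgA.
    have gT : g z x <= expR T * f 0 x.
      apply: (le_trans (segment_flow_growth x sg_ zT)).
      by rewrite -fg0 ler_wpM2r// ler_expR.
    rewrite -mulrBr normrM (ger0_norm (pi_ge0 R)).
    have -> : dq z = A * expR (lam * z) * f 0 x +
        2 * (pi * (A * expR (lam * z))) * (expR T * f 0 x) by rewrite /dq /C; ring.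
    apply: lerD; first exact: fgA.
    rewrite ler_pM// ?mulr_ge0// ?pi_ge0//.
    by rewrite ler_wpM2l// ler_wpM2l// pi_ge0.
  have w0 : w 0 = 0 by rewrite /w fg0 subrr.
  have q0 : 0 <= q 0 by rewrite mulr_ge0// mulr_ge0 ?expR_ge0// divr_ge0.
  have := norm_derive_le_comparison s0 dwE dqE cw cq dwq.
  by rewrite w0 subr0 -/(q s) -/(w s) => /le_trans; apply; rewrite gerBl.
(* The growth bound starts the iteration; it needs [1 <= lam] only. *)
have bound n : forall s x, s \in `[0, T] ->
    `|f s x - g s x| <= 2 ^- n * expR (lam * s) * f 0 x.
  elim: n => [|n IHn] s x sT; last first.
    by rewrite exprSr invfM; apply: contraction => //; rewrite invr_ge0 exprn_ge0.
  have [_ fs0 _] := df s sT; have [_ gs0 _] := dg s sT; have [_ c0 _] := dc.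
  have fs := segment_flow_growth x sf sT; have gs := segment_flow_growth x sg_ sT.
  rewrite -fg0 in gs.
  have es : expR s * f 0 x <= expR (lam * s) * f 0 x.
    rewrite ler_wpM2r// ler_expR ler_peMl//; last by rewrite /lam; lra.
    by move: sT; rewrite in_itv/= => /andP[].
  rewrite expr0 invr1 mul1r ler_norml.
  by have := fs0 x; have := gs0 x; move=> ? ?; apply/andP; split; lra.
move=> s sT; apply/funext => x; apply/eqP; rewrite -subr_eq0 -normr_le0 leNgt.
apply/negP => w0.
pose B := expR (lam * s) * f 0 x.
have [n Bn] : exists n : nat, B / `|f s x - g s x| < n%:R.
  have [_ c0 _] := dc.
  exists (Num.bound (B / `|f s x - g s x|)); apply: archi_boundP.
  by rewrite divr_ge0// mulr_ge0 ?expR_ge0.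
have := bound n s x sT; rewrite -mulrA -/B mulrC ler_pdivlMr ?exprn_gt0// leNgt => /negP; apply.
move: Bn; rewrite ltr_pdivrMr// => /lt_le_trans; apply.
rewrite mulrC ler_pM2l// -natrX ler_nat.
exact/ltnW/ltn_expl.
Qed.

End uniqueness.

Lemma flow_solution_segment J (f : R -> R -> R) (t0 sg T : R) :
  `|sg| = 1 -> 0 < T -> (forall s, s \in `[0, T] -> J (t0 + sg * s)) ->
  flow_solution J f -> segment_flow sg T (fun s => f (t0 + sg * s)).
Proof.
move=> sg1 T0 sJ [df dtf].
have sg0 : sg != 0 by rewrite -normr_gt0 sg1.
have sJ' : `[0, T] `<=` [set s | J (t0 + sg * s)] by move=> s; exact: sJ.
have hd x s : s \in `[0, T] -> has_deriv_within [set s | J (t0 + sg * s)]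
    (fun s => f (t0 + sg * s) x) s
    (sg * ((2 * sin (pi * cdf_of (f (t0 + sg * s)) x) ^+ 2 - 1) * f (t0 + sg * s) x)).
  by move=> /sJ Js; apply: (@has_deriv_within_affine _ _ (f ^~ x)) sg0 (dtf _ _ Js).
split.
- by move=> s /sJ; exact: df.
- by move=> x; exact: (segment_is_derive sJ' (hd x)).
- by move=> x; exact: (segment_continuous T0 sJ' (hd x)).
Qed.

(** The segment from [t0] to [t] is run forward or backward according to the sign
    of [t - t0]. *)
Lemma flow_solution_unique J (f g : R -> R -> R) (t0 : R) : is_interval J -> J t0 ->
  flow_solution J f -> flow_solution J g -> f t0 = g t0 ->
  forall t, J t -> f t = g t.
Proof.
move=> iJ J0 sf sg_ fg0 t Jt.
have [->//|tt0] := eqVneq t t0.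
have T0 : 0 < `|t - t0| by rewrite normr_gt0 subr_eq0.
pose sg := Num.sg (t - t0).
have sg1 : `|sg| = 1 by rewrite normr_sg subr_eq0 tt0.
have tE : t0 + sg * `|t - t0| = t by rewrite -numEsg addrC subrK.
have sJ s : s \in `[0, `|t - t0|] -> J (t0 + sg * s).
  rewrite in_itv/= => /andP[s0 st].
  have [le_t|lt_t] := leP t0 t.
    apply: (iJ _ _ J0 Jt); move: st; rewrite /sg.
    rewrite gtr0_sg ?ger0_norm ?subr_ge0 ?subr_gt0 ?lt_neqAle ?le_t 1?eq_sym ?tt0//.
    by move=> ?; apply/andP; split; lra.
  apply: (iJ _ _ Jt J0); move: st; rewrite /sg ltr0_sg ?ltr0_norm ?subr_lt0//.
  by move=> ?; apply/andP; split; lra.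
have := segment_flow_unique sg1 T0 (flow_solution_segment sg1 T0 sJ sf)
  (flow_solution_segment sg1 T0 sJ sg_).
rewrite mulr0 addr0 => /(_ fg0 `|t - t0|); rewrite tE; apply.
by rewrite in_itv/= lexx normr_ge0.
Qed.

End flow_uniqueness.

(** * The Cauchy solutions *)

Section cauchy_flow.
Context {R : realType}.

Implicit Types (J : set R).

(** [pi F = atan u + pi/2], so [sin^2 (pi F) = cos^2 (atan u) = 1 / (1 + u^2)]
    for [u = (x - m) / gamma]. *)
Lemma sin_sqr_cauchy_cdf (m gamma x : R) : 0 < gamma ->
  2 * sin (pi * cdf_of (cauchy_density m gamma) x) ^+ 2 - 1 =
  (gamma ^+ 2 - (x - m) ^+ 2) / ((x - m) ^+ 2 + gamma ^+ 2).
Proof.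
move=> g0; rewrite cauchy_cdf//.
have -> : pi * (2^-1 + atan ((x - m) / gamma) / pi) = atan ((x - m) / gamma) + pi / 2 :> R.
  by have := pi_gt0 R; move: (atan _) (pi : R) => a p p0; field; rewrite gt_eqF.
rewrite sinDpihalf cos_atan exprVn sqr_sqrtr ?addr_ge0 ?sqr_ge0//.
have := cauchy_den_gt0 m g0 x; rewrite addrC => q0; field.
by rewrite !gt_eqF //= addrC.
Qed.

Lemma cauchy_flow_solution J (m gamma : R) : 0 < gamma ->
  flow_solution J (fun t => cauchy_density m (gamma * expR (- t))).
Proof.
move=> g0.
have gt0 t : 0 < gamma * expR (- t) by rewrite mulr_gt0 ?expR_gt0.
split => [t _|t x _]; first exact: cauchy_is_density.
apply: is_derive_within; rewrite sin_sqr_cauchy_cdf//.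
have q0 := cauchy_den_gt0 m (gt0 t) x.
have ? : pi * ((x - m) ^+ 2 + (gamma * expR (- t)) ^+ 2) != 0.
  by rewrite mulf_neq0 ?gt_eqF ?pi_gt0.
apply: is_derive_eq; rewrite /GRing.scale/= /cauchy_density.
move: (gt0 t) q0 (pi_gt0 R); move: (expR (- t)) (pi : R) => e p e0 q0 p0.
by field; rewrite !gt_eqF.
Qed.

(** Evaluating the equality of densities at each of the two modes gives
    [(m - m')^2 + gamma'^2 = gamma gamma'] and the same with the roles exchanged,
    whence [gamma' <= gamma] and [gamma <= gamma']. *)
Lemma cauchy_density_inj (m gamma m' gamma' : R) : 0 < gamma -> 0 < gamma' ->
  cauchy_density m gamma = cauchy_density m' gamma' -> m = m' /\ gamma = gamma'.
Proof.
move=> g0 g0' e.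
have key n c n' c' : 0 < c -> 0 < c' -> cauchy_density n c = cauchy_density n' c' ->
    (n - n') ^+ 2 + c' ^+ 2 = c * c' :> R.
  move=> c0 c0' /(congr1 (fun h => h n)); rewrite /cauchy_density subrr expr0n/= add0r.
  have := cauchy_den_gt0 n' c0' n; have := pi_gt0 R; move: (pi : R) => p p0 q0.
  have c2 : p * c ^+ 2 != 0 by rewrite gt_eqF// mulr_gt0// exprn_gt0.
  have q2 : p * ((n - n') ^+ 2 + c' ^+ 2) != 0 by rewrite gt_eqF// mulr_gt0.
  move/eqP; rewrite (eqr_div _ _ c2 q2) => /eqP h.
  apply: (mulfI (_ : p * c != 0)); first by rewrite mulf_neq0 ?gt_eqF.
  by rewrite (mulrC p c) -mulrA h; ring.
have h1 := key _ _ _ _ g0 g0' e; have h2 := key _ _ _ _ g0' g0 (esym e).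
have gg : gamma = gamma'.
  have := sqr_ge0 (m - m'); have := sqr_ge0 (m' - m) => ? ?.
  by apply/eqP; rewrite eq_le -(ler_pM2r g0) -[X in _ && X](ler_pM2r g0'); apply/andP; split; lra.
split => //; apply/eqP; rewrite -subr_eq0 -sqrf_eq0; apply/eqP.
by rewrite gg in h1; lra.
Qed.

Lemma flow_solution_eq J (f g : R -> R -> R) : (forall t, J t -> f t = g t) ->
  flow_solution J f -> flow_solution J g.
Proof.
move=> fg [df dtf]; split => [t Jt|t x Jt]; first by rewrite -fg//; exact: df.
apply: (@has_deriv_within_eq _ _ (f ^~ x)) => // [s Js|]; first by rewrite fg.
by rewrite -fg//; exact: dtf.
Qed.

Lemma cauchy_flow_iff (m gamma : R) J (f : R -> R -> R) :
  0 < gamma -> is_interval J -> J 0 ->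
  (flow_solution J f /\ f 0 = cauchy_density m gamma) <->
  (forall t, J t -> f t = cauchy_density m (gamma * expR (- t))).
Proof.
move=> g0 iJ J0; have sc := cauchy_flow_solution J m g0.
have e0 : gamma * expR (- 0) = gamma by rewrite oppr0 expR0 mulr1.
split => [[sf f0] t Jt|fE].
  by apply: (flow_solution_unique iJ J0 sf sc) => //; rewrite f0 e0.
by split; [apply: flow_solution_eq sc => t /fE|rewrite fE// e0].
Qed.

Lemma is_derive_expRN (c t : R) :
  is_derive t 1 (fun s => c * expR (- s)) (- (c * expR (- t))).
Proof. by apply: is_derive_eq; rewrite /GRing.scale/= mulrN1 mulrN. Qed.

(** A solution inside the family agrees with the explicit solution restarted at
    any time [t], and identifiability reads off both parameters near [t].
    Conversely [m] and [gamma e^t] have derivative 0, hence are constant, and the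
    curve is an explicit solution. *)
Lemma cauchy_reduced_dynamics J (m gamma : R -> R) :
  is_interval J -> (forall t, J t -> 0 < gamma t) ->
  flow_solution J (fun t => cauchy_density (m t) (gamma t)) <->
  (forall t, J t -> has_deriv_within J m t 0 /\
                    has_deriv_within J gamma t (- gamma t)).
Proof.
move=> iJ g0; split => [sf t Jt|dmg].
  pose c := gamma t * expR t.
  have c0 : 0 < c by rewrite mulr_gt0 ?expR_gt0 ?g0.
  have ct : c * expR (- t) = gamma t by rewrite /c -mulrA -expRD subrr expR0 mulr1.
  have mgE s : J s -> m s = m t /\ gamma s = c * expR (- s).
    move=> Js; apply: cauchy_density_inj; [exact: g0|by rewrite mulr_gt0 ?expR_gt0|].
    apply: (flow_solution_unique iJ Jt sf (cauchy_flow_solution J (m t) c0)) => //.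
    by rewrite ct.
  split.
    apply: (@has_deriv_within_eq _ _ (cst (m t))) => // [s /mgE[]//|].
    by apply: is_derive_within; exact: is_derive_cst.
  apply: (@has_deriv_within_eq _ _ (fun s => c * expR (- s))) => // [s /mgE[]//|].
  rewrite -ct; apply: is_derive_within; exact: is_derive_expRN.
have [[t0 J0]|Jn] := pselect (exists t0, J t0); last first.
  by split => [t|t x] Jt; exfalso; apply: Jn; exists t.
pose c := gamma t0 * expR t0.
have c0 : 0 < c by rewrite mulr_gt0 ?expR_gt0 ?g0.
apply: flow_solution_eq (cauchy_flow_solution J (m t0) c0) => t Jt.
congr cauchy_density.
  by apply: (has_deriv_within0_cst iJ _ J0 Jt) => s /dmg[].
have dg s : J s -> has_deriv_within J (fun s => gamma s * expR s) s 0.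
  move=> Js; have [_ dgs] := dmg s Js.
  have := has_deriv_withinM dgs (is_derive_within J (is_derive_expR s)).
  by rewrite mulNr addNr.
rewrite /c (has_deriv_within0_cst iJ dg J0 Jt).
by rewrite -mulrA -expRD subrr expR0 mulr1.
Qed.

End cauchy_flow.

(** * Entropy *)

Section entropy_of_cauchy.
Context {R : realType}.
Local Notation mu := (@lebesgue_measure R).

Lemma unit_interval_FTC (h H : R -> R) : continuous h ->
  (forall s : R, 0 <= s -> is_derive s 1 H (h s)) ->
  (\int[mu]_(s in `]0%R, 1%R[) (h s)%:E = (H 1 - H 0)%:E)%E.
Proof.
move=> ch dH.
have mh : measurable_fun setT h by exact: continuous_measurable_fun.
rewrite integral_itv_bndo_bndc; last by apply/measurable_EFinP; exact: measurable_funTS.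
rewrite integral_itv_obnd_cbnd; last by apply/measurable_EFinP; exact: measurable_funTS.
rewrite (@continuous_FTC2 _ h H) ?EFinB//.
- exact: continuous_subspaceT.
- have cH (s : R) : 0 <= s -> {for s, continuous H}.
    by move=> /dH ?; exact/differentiable_continuous/derivable1_diffP/ex_derive.
  split.
  + by move=> s; rewrite in_itv/= => /andP[/ltW/dH ? _]; exact: ex_derive.
  + exact/cvg_at_right_filter/cH.
  + exact/cvg_at_left_filter/cH.
- by move=> s; rewrite in_itv/= => /andP[/ltW/dH ? _]; rewrite derive1E; exact: derive_val.
Qed.

Variables (m gamma : R).
Hypothesis gamma_gt0 : 0 < gamma.
Let f := cauchy_density m gamma.
Let u (x : R) := (x - m) / gamma.
(** The [s]-derivative of [f x * ln (1 + (s u)^2)]. *)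
Let K (s x : R) := 2 * s * u x ^+ 2 * (1 + (s * u x) ^+ 2)^-1 * f x.

Lemma ln_kernel_inner x : (\int[mu]_(s in `]0%R, 1%R[) (K s x)%:E = (f x * ln (1 + u x ^+ 2))%:E)%E.
Proof.
have q0 (s : R) : 0 < 1 + (s * u x) ^+ 2 by rewrite ltr_pwDl// sqr_ge0.
have cK : continuous (K ^~ x).
  move=> s; apply/differentiable_continuous/derivable1_diffP.
  have ? : 1 + (s * u x) ^+ 2 != 0 by rewrite gt_eqF.
  exact: ex_derive.
have dK (s : R) : 0 <= s -> is_derive s 1 (fun s => f x * ln (1 + (s * u x) ^+ 2)) (K s x).
  move=> s0; have dl := is_derive1_ln (q0 s).
  have ? : is_derive s 1 (fun z => 1 + (z * u x) ^+ 2) (2 * s * u x ^+ 2).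
    by apply: is_derive_eq; rewrite /GRing.scale/=; ring.
  have ? : is_derive s 1 (fun z => ln (1 + (z * u x) ^+ 2))
      ((1 + (s * u x) ^+ 2)^-1 * (2 * s * u x ^+ 2)).
    exact: is_derive1_comp.
  by apply: is_derive_eq; rewrite /GRing.scale/= /K; ring.
rewrite (unit_interval_FTC cK dK).
by rewrite mul0r expr0n/= addr0 ln1 mulr0 subr0 mul1r.
Qed.

(** By partial fractions in [x ^+ 2], the kernel is a combination of the densities
    with scales [gamma / s] and [gamma], each of mass 1. *)
Lemma ln_kernel_outer (s : R) : 0 < s < 1 -> (\int[mu]_x (K s x)%:E = (2 / (1 + s))%:E)%E.
Proof.
move=> /andP[s0 s1].
have gs : 0 < gamma / s by rewrite divr_gt0.
have s21 : 1 - s ^+ 2 != 0 by rewrite gt_eqF// subr_gt0 expr_lt1// ltW.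
have KE x : K s x = (2 / (1 - s ^+ 2)) * cauchy_density m (gamma / s) x -
                    (2 * s / (1 - s ^+ 2)) * cauchy_density m gamma x.
  rewrite /K /u /f /cauchy_density.
  have := cauchy_den_gt0 m gamma_gt0 x; have := cauchy_den_gt0 m gs x.
  have := pi_gt0 R; move: (pi : R) => p p0 q1 q2.
  have q1' : (x - m) ^+ 2 * s ^+ 2 + gamma ^+ 2 != 0.
    by rewrite gt_eqF// ltr_wpDl ?exprn_gt0// mulr_ge0 ?sqr_ge0.
  field.
  by rewrite s21 exprMn q1' !gt_eqF.
have [_ _ i1] := cauchy_is_density m gs; have [_ _ i2] := cauchy_is_density m gamma_gt0.
have int1 := density_integrable (@measurableT _ (measurableTypeR R)) (cauchy_is_density m gs).
have int2 := density_integrable (@measurableT _ (measurableTypeR R)) (cauchy_is_density m gamma_gt0).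
under eq_integral do rewrite KE EFinB
  (EFinM _ (cauchy_density m (gamma / s) _)) (EFinM _ (cauchy_density m gamma _)).
rewrite integralB//; [|exact: integrableZl|exact: integrableZl].
rewrite (integralZl _ int1)// (integralZl _ int2)// i1 i2 !mule1 -EFinB; congr EFin.
have ? : 1 + s != 0 by rewrite gt_eqF// addr_gt0.
by field; apply/andP.
Qed.

Lemma integral_two_div : (\int[mu]_(s in `]0%R, 1%R[) (2 / (1 + s))%:E = (2 * ln 2)%:E)%E.
Proof.
(* [1 + |s|] agrees with [1 + s] on the interval and never vanishes. *)
pose h (s : R) := 2 / (1 + `|s|).
have nz (s : R) : 1 + `|s| != 0 by rewrite gt_eqF// ltr_pwDl.
have ch : continuous h.
  move=> s; apply: cvgM; first exact: cvg_cst.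
  by apply: cvgV => //; apply: cvgD; [exact: cvg_cst|exact: cvg_norm].
transitivity (\int[mu]_(s in `]0%R, 1%R[) (h s)%:E)%E.
  apply: eq_integral => s; rewrite inE/= in_itv/= => /andP[s0 _].
  by rewrite /h gtr0_norm.
have dh (s : R) : 0 <= s -> is_derive s 1 (fun s => 2 * ln (1 + s)) (h s).
  move=> s0; have s1 : 0 < 1 + s by rewrite ltr_pwDl.
  have dl := is_derive1_ln s1.
  have ? : is_derive s 1 (fun z => ln (1 + z)) ((1 + s)^-1 * 1).
    by apply: (@is_derive1_comp _ (@ln R)); apply: is_derive_eq; rewrite add0r.
  by apply: is_derive_eq; rewrite /GRing.scale/= /h ger0_norm// mulr1.
by rewrite (unit_interval_FTC ch dh) addr0 ln1 mulr0 subr0.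
Qed.

(** Tonelli's theorem for the nonnegative kernel [K] on the strip [0 < s < 1]. *)
Lemma cauchy_integral_ln :
  (\int[mu]_x (f x * ln (1 + u x ^+ 2))%:E = (ln 4)%:E)%E.
Proof.
have -> : ln 4 = 2 * ln 2 :> R.
  have -> : 4 = 2 ^+ 2 :> R by rewrite -natrX.
  by rewrite lnXn// mulr_natl.
rewrite -integral_two_div.
pose k (z : measurableTypeR R * measurableTypeR R) : \bar R :=
  (K z.2 z.1 * \1_`]0%R, 1%R[ z.2)%:E.
have mk : measurable_fun setT k.
  apply/measurable_EFinP.
  have m1 : measurable_fun setT (fst : measurableTypeR R * measurableTypeR R -> _) by exact: measurable_fst.
  have m2 : measurable_fun setT (snd : measurableTypeR R * measurableTypeR R -> _) by exact: measurable_snd.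
  have mu1 : measurable_fun setT (fun z : measurableTypeR R * measurableTypeR R => u z.1).
    by apply: measurable_funM => //; apply: measurable_funB.
  apply: measurable_funM; last exact: (measurableT_comp (measurable_indic _)).
  apply: measurable_funM; last exact: (measurableT_comp (measurable_cauchy_density _ _)).
  apply: measurable_funM.
    by apply: measurable_funM; [apply: measurable_funM|exact: measurable_funX].
  (* The denominator never vanishes, so its inverse is continuous on the line and
     composes with the product-measurable argument [s * u]. *)
  have mV : measurable_fun setT (fun y : R => (1 + y ^+ 2)^-1).
    by apply: continuous_measurable_fun; exact: continuous_oneDsqrV.
  by apply: (measurableT_comp mV); apply: measurable_funM.
have k0 z : (0 <= k z)%E.
  rewrite /k lee_fin indicE; case: (boolP (_ \in _)) => [|_]; last by rewrite mulr0.
  rewrite inE/= in_itv/= mulr1 => /andP[s0 _].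
  rewrite mulr_ge0 ?(ltW (cauchy_density_gt0 _ _ _))//.
  rewrite mulr_ge0 ?invr_ge0 ?addr_ge0 ?sqr_ge0//.
  by rewrite mulr_ge0 ?sqr_ge0// mulr_ge0// ltW.
have := fubini_tonelli (m1 := mu) (m2 := mu) k mk k0.
have -> : (\int[mu]_x \int[mu]_s k (x, s) = \int[mu]_x (f x * ln (1 + u x ^+ 2))%:E)%E.
  apply: eq_integral => x _; rewrite -ln_kernel_inner [RHS]integral_mkcond.
  by apply: eq_integral => s _; rewrite patchE /k indicE; case: ifPn; rewrite (mulr1, mulr0).
move=> ->; rewrite [RHS]integral_mkcond; apply: eq_integral => s _.
rewrite patchE; case: ifPn => sI.
  rewrite -ln_kernel_outer; last by move: sI; rewrite inE/= in_itv.
  by apply: eq_integral => x _; rewrite /k indicE sI mulr1.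
by rewrite integral0_eq// => x _; rewrite /k indicE (negPf sI) mulr0.
Qed.

(** [ln f = - ln (pi gamma) - ln (1 + u^2)], and the mean of [ln (1 + u^2)] is
    [ln 4]. *)
Lemma cauchy_entropy : entropy f = (ln (4 * pi * gamma))%:E.
Proof.
have pg : 0 < pi * gamma by rewrite mulr_gt0 ?pi_gt0.
have q0 x : 0 < 1 + u x ^+ 2 by rewrite ltr_pwDl// sqr_ge0.
have fE x : f x = (pi * gamma * (1 + u x ^+ 2))^-1.
  rewrite /f /cauchy_density /u.
  have := cauchy_den_gt0 m gamma_gt0 x; have := pi_gt0 R.
  move: (pi : R) => p p0 q1; field.
  by rewrite !gt_eqF//= addrC.
have lnf x : f x * ln (f x) = - ln (pi * gamma) * f x - f x * ln (1 + u x ^+ 2).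
  have -> : ln (f x) = - (ln (pi * gamma) + ln (1 + u x ^+ 2)).
    by rewrite fE lnV ?posrE; [rewrite lnM ?posrE|exact: mulr_gt0].
  by ring.
have df := cauchy_is_density m gamma_gt0; have [_ _ f1] := df.
have int1 := density_integrable (@measurableT _ (measurableTypeR R)) df.
have ml : measurable_fun setT (fun x => f x * ln (1 + u x ^+ 2)).
  apply: measurable_funM; first exact: measurable_cauchy_density.
  apply: measurableT_comp => //; apply: measurable_funD => //; apply: measurable_funX.
  by apply: measurable_funM => //; apply: measurable_funB.
have int2 : mu.-integrable setT (fun x => (f x * ln (1 + u x ^+ 2))%:E).
  apply/integrableP; split; first exact/measurable_EFinP.
  under eq_integral => x _.
    rewrite abse_EFin ger0_norm; first over.
    by rewrite mulr_ge0 ?ln_ge0 ?lerDl ?sqr_ge0// ltW// cauchy_density_gt0.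
  by rewrite cauchy_integral_ln ltry.
rewrite /entropy.
under eq_integral do rewrite lnf EFinB (EFinM _ (f _)).
rewrite integralB//; last exact: integrableZl.
rewrite (integralZl _ int1)// cauchy_integral_ln f1 mule1 -EFinB -EFinN; congr EFin.
by rewrite -mulrA (lnM (_ : 4 \in Num.pos)) ?posrE// opprD !opprK addrC.
Qed.

End entropy_of_cauchy.

Section entropy_law.
Context {R : realType}.

Lemma cauchy_flow_entropy (m gamma : R) (J : set R) (f : R -> R -> R) :
  0 < gamma -> (forall t, J t -> f t = cauchy_density m (gamma * expR (- t))) ->
  forall t, J t ->
    entropy (f t) = (ln (4 * pi * (gamma * expR (- t))))%:E /\
    has_deriv_within J (fun s => fine (entropy (f s))) t (- 1).
Proof.
move=> g0 fE.
have gt0 t : 0 < gamma * expR (- t) by rewrite mulr_gt0 ?expR_gt0.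
have entE t : J t -> entropy (f t) = (ln (4 * pi * (gamma * expR (- t))))%:E.
  by move=> /fE ->; exact: cauchy_entropy.
move=> t Jt; split; first exact: entE.
apply: (@has_deriv_within_eq _ _ (fun s => ln (4 * pi * gamma) - s)) => // [s Js|].
  have p0 : 0 < 4 * pi * gamma by rewrite !mulr_gt0 ?pi_gt0.
  by rewrite entE//= mulrA [in RHS]lnM ?posrE ?expR_gt0// expRK.
by apply: is_derive_within; apply: is_derive_eq; rewrite add0r mul1r.
Qed.

End entropy_law.

(** * Fisher information *)

Section fisher_information.
Context {R : realType}.
Local Notation mu := (@lebesgue_measure R).

(** Since [theta' = pi f], a function [phi] of the angle integrates against the
    Cauchy density as against the uniform law on [(-pi/2, pi/2)]: any primitive
    [Phi] of [phi] gives the primitive [Phi \o theta / pi] of the integrand. *)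
Section angle.
Variables (m gamma : R).
Hypothesis gamma_gt0 : 0 < gamma.
Let f := cauchy_density m gamma.
Let theta (x : R) : R := atan ((x - m) / gamma).

Variables (Phi phi : R -> R) (C : R).
Hypotheses (dPhi : forall t : R, is_derive t 1 Phi (phi t)) (cphi : continuous phi)
  (phiC : forall t, `|phi t| <= C).

Let is_derive_theta (x : R) : is_derive x 1 theta (pi * f x).
Proof.
have ? := is_derive_cauchy_cdf m gamma_gt0 x.
have p0 : pi != 0 :> R by rewrite gt_eqF ?pi_gt0.
have -> : theta = (fun y => pi * ((2^-1 + atan ((y - m) / gamma) / pi) - 2^-1)).
  by apply/funext => y; rewrite addrC addKr mulrC divfK.
by apply: is_derive_eq; rewrite /GRing.scale/= mulr0 subr0.
Qed.

Let cf : continuous f := continuous_cauchy_density gamma_gt0.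
Let dH (x : R) : is_derive x 1 (fun x => C * (2^-1 + atan ((x - m) / gamma) / pi)) (C * f x).
Proof. by have ? := is_derive_cauchy_cdf m gamma_gt0 x; exact: is_derive_eq. Qed.

Let cg : continuous (fun x => phi (theta x) * f x).
Proof.
have ctheta := is_derive_continuous is_derive_theta.
move=> x; apply: cvgM; last exact: cf.
by apply: (@continuous_comp _ _ _ theta phi); [exact: ctheta|exact: cphi].
Qed.

Let dG (x : R) : is_derive x 1 (fun x => Phi (theta x) / pi) (phi (theta x) * f x).
Proof.
have ? := is_derive_theta x; have ? := dPhi (theta x).
have ? : is_derive x 1 (Phi \o theta) (phi (theta x) * (pi * f x)) by exact: is_derive1_comp.
have p0 : pi != 0 :> R by rewrite gt_eqF ?pi_gt0.
have -> : (fun x => Phi (theta x) / pi) = (fun x => pi^-1 * (Phi \o theta) x).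
  by apply/funext => y; rewrite mulrC.
apply: is_derive_eq; rewrite /GRing.scale/=.
by rewrite mulrCA; congr (_ * _); rewrite mulrA mulVf ?mul1r.
Qed.

Let gh x : `|phi (theta x) * f x| <= C * f x.
Proof.
have f0 := cauchy_density_gt0 m gamma_gt0 x.
by rewrite normrM (gtr0_norm f0) ler_wpM2r// ltW.
Qed.

Let cvg_angle (F : set_system R) {FF : Filter F} (a : R) :
  theta x @[x --> F] --> a -> (Phi (theta x) / pi) @[x --> F] --> Phi a / pi.
Proof.
move=> ta; apply: cvgM; last exact: cvg_cst.
by apply: (cvg_comp theta Phi ta); exact: (is_derive_continuous dPhi).
Qed.

Lemma cauchy_angle_integrable :
  mu.-integrable setT (EFin \o (fun x => phi (theta x) * f x)).
Proof.
apply: (@dominated_integrable _ (fun x => C * f x)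
  (fun x => C * (2^-1 + atan ((x - m) / gamma) / pi)) _ (C * 0) (C * 1)) => //.
- by move=> x; apply: cvgM; [exact: cvg_cst|exact: cf].
- by apply: cvgM; [exact: cvg_cst|exact: cauchy_cdf_cvgNy].
- by apply: cvgM; [exact: cvg_cst|exact: cauchy_cdf_cvgy].
Qed.

Lemma cauchy_angle_integral :
  \int[mu]_x (phi (theta x) * f x) = (Phi (pi / 2) - Phi (- (pi / 2))) / pi.
Proof.
rewrite mulrBl; apply: (@dominated_FTC2T _ (fun x => C * f x)
  (fun x => C * (2^-1 + atan ((x - m) / gamma) / pi)) _
  (fun x => Phi (theta x) / pi) (C * 0) (C * 1)) => //.
- by move=> x; apply: cvgM; [exact: cvg_cst|exact: cf].
- by apply: cvgM; [exact: cvg_cst|exact: cauchy_cdf_cvgNy].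
- by apply: cvgM; [exact: cvg_cst|exact: cauchy_cdf_cvgy].
- by apply: cvg_angle; exact: cvgNy_atan_affine.
- by apply: cvg_angle; exact: cvgy_atan_affine.
Qed.
End angle.

Implicit Types (theta : 'rV[R]_2).

(** A partial derivative of a function given by its coordinates is an ordinary
    derivative in the corresponding variable. *)
Lemma pderiv_gamma (k : R -> R -> R) theta (d : R) :
  is_derive (theta 0 1) 1 (k (theta 0 0)) d ->
  pderiv 1 (fun z => k (z 0 0) (z 0 1)) theta = d.
Proof.
case=> dk <-.
pose q (h : R) := h^-1 * (k (theta 0 0) (h + theta 0 1) - k (theta 0 0) (theta 0 1)).
pose q' (h : R) := h^-1 * (k ((h *: delta_mx 0 1 + theta) 0 0) ((h *: delta_mx 0 1 + theta) 0 1)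
  - k (theta 0 0) (theta 0 1)).
have e : q = q'.
  by apply/funext => h; rewrite /q /q' !mxE/= !(mulr0, mulr1) add0r.
have eq1 : q = (fun h => h^-1 *: (((k (theta 0 0)) \o shift (theta 0 1)) (h *: (1 : R)) -
    k (theta 0 0) (theta 0 1))).
  by apply/funext => h; rewrite /q /= [_%:A]mulr1.
have {}dk : q h @[h --> (0 : R)^'] --> 'D_1 (k (theta 0 0)) (theta 0 1) by rewrite eq1; exact: dk.
by rewrite e in dk; apply: cvg_lim.
Qed.

Lemma pderiv_m (k : R -> R -> R) theta (d : R) :
  is_derive (theta 0 0) 1 (k ^~ (theta 0 1)) d ->
  pderiv 0 (fun z => k (z 0 0) (z 0 1)) theta = d.
Proof.
case=> dk <-.
pose q (h : R) := h^-1 * (k (h + theta 0 0) (theta 0 1) - k (theta 0 0) (theta 0 1)).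
pose q' (h : R) := h^-1 * (k ((h *: delta_mx 0 0 + theta) 0 0) ((h *: delta_mx 0 0 + theta) 0 1)
  - k (theta 0 0) (theta 0 1)).
have e : q = q'.
  by apply/funext => h; rewrite /q /q' !mxE/= !(mulr0, mulr1) add0r.
have eq1 : q = (fun h => h^-1 *: (((k ^~ (theta 0 1)) \o shift (theta 0 0)) (h *: (1 : R)) -
    k (theta 0 0) (theta 0 1))).
  by apply/funext => h; rewrite /q /= [_%:A]mulr1.
have {}dk : q h @[h --> (0 : R)^'] --> 'D_1 (k ^~ (theta 0 1)) (theta 0 0) by rewrite eq1; exact: dk.
by rewrite e in dk; apply: cvg_lim.
Qed.

Lemma is_derive_ln_comp (k : R -> R) (t d : R) : 0 < k t ->
  is_derive t 1 k d -> is_derive t 1 (fun s => ln (k s)) (d / k t).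
Proof.
move=> k0 dk; have dl := is_derive1_ln k0; rewrite mulrC.
exact: (@is_derive1_comp _ (@ln R) k).
Qed.

Lemma cos_atan_sqr (z : R) : cos (atan z) ^+ 2 = (1 + z ^+ 2)^-1.
Proof. by rewrite cos_atan exprVn sqr_sqrtr// addr_ge0// sqr_ge0. Qed.

Lemma sin_atan (z : R) : sin (atan z) = z * cos (atan z).
Proof.
have c0 : cos (atan z) != 0 by rewrite gt_eqF// cos_gt0_pihalf// atan_gtNpi2 atan_ltpi2.
by rewrite -{2}(atanK z) /tan divfK.
Qed.

Lemma sin_double_atan (z : R) : sin (2 * atan z) = 2 * z / (1 + z ^+ 2).
Proof.
by rewrite mulr_natl sin_mulr2n sin_atan -cos_atan_sqr -mulr_natl; ring.
Qed.

Lemma cos_double_atan (z : R) : cos (2 * atan z) = (1 - z ^+ 2) / (1 + z ^+ 2).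
Proof.
have z0 : 1 + z ^+ 2 != 0 by rewrite gt_eqF// ltr_pwDl// sqr_ge0.
by rewrite mulr_natl cos_mulr2n cos_atan_sqr -mulr_natl; field.
Qed.

Section score.
Variable theta : 'rV[R]_2.
Hypothesis theta_gt0 : half_plane theta.
Let g0 : 0 < theta 0 1. Proof. exact: theta_gt0. Qed.
Let angle (x : R) : R := atan ((x - theta 0 0) / theta 0 1).
Let q0 x : 0 < (x - theta 0 0) ^+ 2 + theta 0 1 ^+ 2.
Proof. exact: cauchy_den_gt0. Qed.

(** In terms of [u = tan angle], the scores are [2 u / (1 + u^2)] and
    [(u^2 - 1) / (1 + u^2)] over [gamma]: the half-angle expressions of
    [sin (2 angle)] and [- cos (2 angle)]. *)
Lemma score_m x : score cauchy_family 0 theta x = sin (2 * angle x) / theta 0 1.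
Proof.
have f0 := cauchy_density_gt0 (theta 0 0) g0 x.
apply: (@pderiv_m (fun a b => ln (cauchy_density a b x))).
have p0 : pi * ((x - theta 0 0) ^+ 2 + theta 0 1 ^+ 2) != 0.
  by rewrite mulf_neq0 ?gt_eqF// pi_gt0.
have dk : is_derive (theta 0 0) 1 (fun a => cauchy_density a (theta 0 1) x)
    (sin (2 * angle x) / theta 0 1 * cauchy_density (theta 0 0) (theta 0 1) x).
  rewrite sin_double_atan /cauchy_density; apply: is_derive_eq; rewrite /GRing.scale/=.
  have := pi_gt0 R; move: (pi : R) p0 => p p0 p1.
  by field; rewrite !gt_eqF.
have := is_derive_ln_comp (k := fun a => cauchy_density a (theta 0 1) x) f0 dk => dl.
refine (is_derive_eq dl _).
by rewrite mulfK// gt_eqF.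
Qed.

Lemma score_gamma x : score cauchy_family 1 theta x = - cos (2 * angle x) / theta 0 1.
Proof.
have f0 := cauchy_density_gt0 (theta 0 0) g0 x.
apply: (@pderiv_gamma (fun a b => ln (cauchy_density a b x))).
have p0 : pi * ((x - theta 0 0) ^+ 2 + theta 0 1 ^+ 2) != 0.
  by rewrite mulf_neq0 ?gt_eqF// pi_gt0.
have dk : is_derive (theta 0 1) 1 (fun b => cauchy_density (theta 0 0) b x)
    (- cos (2 * angle x) / theta 0 1 * cauchy_density (theta 0 0) (theta 0 1) x).
  rewrite cos_double_atan /cauchy_density; apply: is_derive_eq; rewrite /GRing.scale/=.
  have := pi_gt0 R; move: (pi : R) p0 => p p0 p1.
  by field; rewrite !gt_eqF.
have := is_derive_ln_comp (k := fun b => cauchy_density (theta 0 0) b x) f0 dk => dl.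
refine (is_derive_eq dl _).
by rewrite mulfK// gt_eqF.
Qed.

Lemma cauchy_family_ln_differentiable x :
  differentiable (fun z => ln (cauchy_family z x)) theta.
Proof.
have f0 := cauchy_density_gt0 (theta 0 0) g0 x.
apply: (@differentiable_comp _ _ _ _ (fun z : 'rV[R]_2 => cauchy_family z x) (@ln R)).
  rewrite /cauchy_family /cauchy_density.
  have d0 := @differentiable_coord _ _ _ theta 0 0.
  have d1 := @differentiable_coord _ _ _ theta 0 1.
  have p0 : pi * ((x - theta 0 0) ^+ 2 + theta 0 1 ^+ 2) != 0.
    by rewrite mulf_neq0 ?gt_eqF// pi_gt0.
  apply: differentiableM => //; apply: differentiableV => //.
  apply: differentiableM => //; apply: differentiableD; apply: differentiableM => //;
    exact: differentiableB.
by apply/derivable1_diffP; have [] := is_derive1_ln f0.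
Qed.

End score.

Lemma ord2P (i : 'I_2) : i = 0 \/ i = 1.
Proof. by case: i => [[|[|//]] ?]; [left|right]; apply/val_inj. Qed.

Section fisher.
Variable theta : 'rV[R]_2.
Hypothesis theta_gt0 : half_plane theta.
Let g0 : 0 < theta 0 1. Proof. exact: theta_gt0. Qed.
Let f := cauchy_density (theta 0 0) (theta 0 1).
Let angle (x : R) : R := atan ((x - theta 0 0) / theta 0 1).

Let r := theta 0 1 ^- 2.
Let r0 : 0 <= r. Proof. by rewrite invr_ge0 sqr_ge0. Qed.

Let phi (i j : 'I_2) (t : R) : R :=
  r * ((if i == 0 then sin (2 * t) else - cos (2 * t)) *
       (if j == 0 then sin (2 * t) else - cos (2 * t))).

(** Primitives of [phi]: the signs are those of [sin^2 (2 t) = (1 - cos (4 t)) / 2]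
    and [cos^2 (2 t) = (1 + cos (4 t)) / 2], and [(-1) ^+ i] chooses between them
    on the diagonal. *)
Let Phi (i j : 'I_2) (t : R) : R :=
  r * (if i == j then t / 2 - (-1) ^+ i * sin (2 * t) * cos (2 * t) / 4
       else - sin (2 * t) ^+ 2 / 4).

Let dPhi i j (t : R) : is_derive t 1 (Phi i j) (phi i j t).
Proof.
have e := cos2Dsin2 (2 * t).
case: (ord2P i) => ->; case: (ord2P j) => ->; rewrite /Phi /phi /=;
  apply: is_derive_eq; rewrite /GRing.scale/=.
all: have {}e : r * cos (2 * t) ^+ 2 + r * sin (2 * t) ^+ 2 = r by rewrite -mulrDr e mulr1.
all: move: (sin _) (cos _) e => S C e; rewrite ?expr0 ?expr1.
all: by lra.
Qed.

Let cphi i j : continuous (phi i j).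
Proof.
move=> t; case: (ord2P i) => ->; case: (ord2P j) => ->; rewrite /phi /=;
  apply/differentiable_continuous/derivable1_diffP; exact: ex_derive.
Qed.

Let phi_le i j t : `|phi i j t| <= r.
Proof.
rewrite /phi normrM (ger0_norm r0) ler_piMr// normrM.
by rewrite mulr_ile1//; case: ifP => _; rewrite ?normrN ?sin_max ?cos_max.
Qed.

Let scoreE i j x :
  score cauchy_family i theta x * score cauchy_family j theta x *
    cauchy_family theta x = phi i j (angle x) * f x.
Proof.
rewrite -/f /phi /r; congr (_ * _).
by case: (ord2P i) => ->; case: (ord2P j) => ->; rewrite ?score_m ?score_gamma//=; field; rewrite gt_eqF.
Qed.

Let scoreF i j : (fun x => score cauchy_family i theta x * score cauchy_family j theta x *
    cauchy_family theta x) = (fun x => phi i j (angle x) * f x).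
Proof. by apply/funext => x; exact: scoreE. Qed.

Lemma cauchy_fisher_regular : fisher_regular cauchy_family theta.
Proof.
split => [x|i j]; first exact: cauchy_family_ln_differentiable.
rewrite (_ : (fun x => _) = (EFin \o (fun x => phi i j (angle x) * f x))).
  exact: cauchy_angle_integrable (@cphi i j) (@phi_le i j).
by apply/funext => x; rewrite scoreE.
Qed.

(** [sin (2 t)] vanishes at [-pi/2] and [pi/2], so only the linear part [t / 2] of
    the diagonal primitives contributes. *)
Lemma cauchy_fisher_metric :
  fisher_metric cauchy_family theta = (2 * theta 0 1 ^+ 2)^-1%:M.
Proof.
have p0 : pi != 0 :> R by rewrite gt_eqF ?pi_gt0.
have s1 : sin (2 * (pi / 2)) = 0 :> R by rewrite mulrC divfK// sinpi.
apply/matrixP => i j; rewrite !mxE scoreF.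
rewrite (cauchy_angle_integral _ g0 (@dPhi i j) (@cphi i j) (@phi_le i j)).
rewrite /Phi mulrN sinN s1 /r.
have g1 : theta 0 1 != 0 by rewrite gt_eqF.
move: (pi : R) p0 => p p0.
case: (ord2P i) => ->; case: (ord2P j) => ->;
  rewrite /= !(oppr0, mulr0, mul0r, expr0n, subr0, mulr1n, mulr0n)//=.
all: by field; rewrite ?p0 ?g1.
Qed.

End fisher.

End fisher_information.

(** * The half-plane with metric proportional to the identity over gamma^2 *)

Section half_plane_geometry.
Context {R : realType}.

Implicit Types (theta : 'rV[R]_2).

Lemma inner_scalar (c : R) (g : 'rV[R]_2 -> 'M[R]_2) z (u : 'rV[R]_2) : g z = c%:M ->
  inner g z u u = c * (u 0 0 ^+ 2 + u 0 1 ^+ 2).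
Proof.
move=> gE; rewrite /inner gE mul_mx_scalar -scalemxAl !mxE.
rewrite !big_ord_recl big_ord0 !mxE addr0 -!expr2.
by congr (_ * (_ + _ ^+ 2)); congr (u _ _); apply/val_inj.
Qed.

Lemma half_plane_near theta : half_plane theta -> \forall z \near theta, half_plane z.
Proof.
move=> t0; have c : (fun z : 'rV[R]_2 => z 0 1) @ theta --> theta 0 1.
  exact: differentiable_continuous (differentiable_coord theta 0 1).
exact: (c _ (lt_nbhsr t0)).
Qed.

Lemma half_plane_eq_pderiv (h k : 'rV[R]_2 -> R) i theta : half_plane theta ->
  (forall z, half_plane z -> h z = k z) -> pderiv i h theta = pderiv i k theta.
Proof.
move=> t0 hk; apply: near_eq_derive; move: (half_plane_near t0).
by apply: filterS => z /hk.
Qed.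

(** A class of functions closed under partial derivatives that contains the metric
    coefficients and the Christoffel symbols: powers of the second coordinate on
    the half-plane, with no condition elsewhere. *)
Definition gamma_power (h : 'rV[R]_2 -> R) : Prop :=
  exists (c : R) (k : nat), forall z, half_plane z -> h z = c * z 0 1 ^- k.

Lemma is_derive_power (c t : R) k : 0 < t ->
  is_derive t 1 (fun b => c * b ^- k) (- k%:R * c * t ^- k.+1).
Proof.
move=> t0; have tN0 : t != 0 by rewrite gt_eqF.
have tk : t ^+ k != 0 by rewrite expf_neq0.
have d1 : is_derive t 1 (fun b : R => b ^+ k) (k%:R * t ^+ k.-1).
  by apply: DeriveDef; [exact: exprn_derivable|rewrite exp_derive /GRing.scale/= mulr1].
have dV := is_deriveV (f := fun b => b ^+ k) tk d1.
apply: is_derive_eq; rewrite /GRing.scale/=.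
case: k tk {d1 dV} => [|k] tk; first by rewrite !(mul0r, mulr0, oppr0, addr0).
have := expf_neq0 k tN0.
rewrite /= !exprS; move: (t ^+ k) => y y0; field.
by rewrite y0 tN0.
Qed.

(** The linear part of [k] serves for [h], because the first-order expansion is a
    condition on germs; uniqueness of the differential concludes. *)
Lemma near_eq_differentiable (h k : 'rV[R]_2 -> R) theta :
  (\forall z \near theta, h z = k z) -> differentiable k theta ->
  differentiable h theta.
Proof.
move=> hk /diff_locallyP[dkc /eqaddoP kE].
have hkt : h theta = k theta by exact: nbhs_singleton hk.
have hE : h \o shift theta = cst (h theta) + 'd k theta +o_ (0 : 'rV[R]_2) id.
  apply/eqaddoP => e e0; have {}kE := kE e e0.
  have {}hk : \forall z \near (0 : 'rV[R]_2), h (z + theta) = k (z + theta).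
    by move: hk; rewrite (near_shift 0) subr0.
  apply: filterS2 hk kE => z /= hk.
  by rewrite /= !fctE /= hk hkt.
apply/diff_locallyP; rewrite (diff_unique dkc hE); split => //.
Qed.

Lemma gamma_power_differentiable (h : 'rV[R]_2 -> R) theta :
  half_plane theta -> gamma_power h -> differentiable h theta.
Proof.
move=> t0 [c [k hE]].
apply: (@near_eq_differentiable _ (fun z => c * z 0 1 ^- k)).
  by move: (half_plane_near t0); apply: filterS.
apply: (@differentiable_comp _ _ _ _ (fun z : 'rV[R]_2 => z 0 1) (fun b => c * b ^- k)).
  exact: differentiable_coord.
by apply/derivable1_diffP; have [] := is_derive_power c k t0.
Qed.

Lemma pderiv_gamma_power (h : 'rV[R]_2 -> R) c k i theta :
  (forall z, half_plane z -> h z = c * z 0 1 ^- k) -> half_plane theta ->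
  pderiv i h theta = (if i == 0 then 0 else - k%:R * c) * theta 0 1 ^- k.+1.
Proof.
move=> hE t0; rewrite (half_plane_eq_pderiv i t0 hE).
case: (ord2P i) => -> /=.
  rewrite mul0r; apply: (@pderiv_m _ (fun _ b => c * b ^- k)).
  exact: is_derive_cst.
apply: (@pderiv_gamma _ (fun _ b => c * b ^- k)).
exact: is_derive_power.
Qed.

(** Iterated partial derivatives stay in a class of differentiable functions. *)
Lemma gamma_power_smooth (h : 'rV[R]_2 -> R) :
  gamma_power h -> smooth_on half_plane h.
Proof.
move=> hp w theta t0; apply: gamma_power_differentiable => //.
elim: w => [//|i w [c [k IH]]] /=.
exists (if i == 0 then 0 else - k%:R * c), k.+1 => z z0.
exact: pderiv_gamma_power.
Qed.

Section metric.
Variable g : 'rV[R]_2 -> 'M[R]_2.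
Hypothesis gE : forall z, half_plane z -> g z = (2 * z 0 1 ^+ 2)^-1%:M.

Lemma metric_entry i j z : half_plane z -> g z i j = (i == j)%:R / 2 * z 0 1 ^- 2.
Proof.
by move=> z0; rewrite gE// mxE -[LHS]mulr_natl invfM mulrA.
Qed.

Lemma metric_riemannian : riemannian_metric half_plane g.
Proof.
split.
- move=> i j; apply: gamma_power_smooth; exists ((i == j)%:R / 2), 2%N => z.
  exact: metric_entry.
- by move=> theta t0; rewrite gE// tr_scalar_mx.
- move=> theta v t0 v0; rewrite (inner_scalar v (gE t0)).
  rewrite mulr_gt0 ?invr_gt0 ?mulr_gt0 ?exprn_gt0//.
  rewrite lt0r paddr_eq0 ?addr_ge0 ?sqr_ge0// andbT !sqrf_eq0.
  apply: contra v0 => /andP[/eqP v00 /eqP v01]; apply/eqP/rowP => j.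
  by rewrite mxE; case: (ord2P j) => ->.
Qed.

(** The Christoffel symbols of a metric proportional to [gamma ^- 2] times the
    identity are these constants divided by [gamma]. *)
Definition hp_christoffel (k i j : 'I_2) : R :=
  (k == 1)%:R * (i == j)%:R - (i == 1)%:R * (j == k)%:R - (j == 1)%:R * (i == k)%:R.

Lemma christoffelE k i j z : half_plane z ->
  christoffel g k i j z = hp_christoffel k i j * z 0 1 ^- 1.
Proof.
move=> z0; have zN0 : z 0 1 != 0 by rewrite gt_eqF.
have dg a b c : pderiv a (fun y => g y b c) z =
    - (a == 1)%:R * (b == c)%:R * z 0 1 ^- 3.
  rewrite (pderiv_gamma_power a (fun y => metric_entry b c (z:=y)) z0).
  by case: (ord2P a) => -> /=; rewrite ?(oppr0, mul0r)//; field.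
rewrite /christoffel gE// invmx_scalar invrK.
rewrite (bigD1 k)//= big1 ?addr0; last first.
  by move=> l lk; rewrite mxE eq_sym (negPf lk) mulr0n mul0r.
rewrite mxE eqxx mulr1n !dg /hp_christoffel.
by field.
Qed.

Lemma metric_gauss_curvature z : half_plane z -> gauss_curvature g z = - 2.
Proof.
move=> z0; have zN0 : z 0 1 != 0 by rewrite gt_eqF.
have cE k i j : christoffel g k i j z = hp_christoffel k i j * z 0 1 ^- 1 by exact: christoffelE.
have dcE a k i j : pderiv a (christoffel g k i j) z =
    - (a == 1)%:R * hp_christoffel k i j * z 0 1 ^- 2.
  rewrite (pderiv_gamma_power a (fun y => @christoffelE k i j y) z0).
  by case: (ord2P a) => -> /=; rewrite ?(oppr0, mul0r)//.
rewrite /gauss_curvature gE// det_scalar !big_ord_recl big_ord0 !mxE/= mulr0n mul0r addr0 mulr1n.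
rewrite /curvature_tensor !dcE !big_ord_recl big_ord0 !cE /hp_christoffel/=.
by field.
Qed.
End metric.

Lemma is_derive_hp_point (a b : R -> R) (t da db : R) :
  is_derive t 1 a da -> is_derive t 1 b db ->
  is_derive t 1 (fun s => hp_point (a s) (b s)) (hp_point da db).
Proof.
move=> [dea dva] [deb dvb].
have dc : derivable (fun s => hp_point (a s) (b s)) t 1.
  apply/derivable_mxP => i j.
  rewrite (_ : (fun s => _) = if j == 0 then a else b); first by case: ifP.
  by apply/funext => s; rewrite mxE; case: ifP.
apply: DeriveDef => //; rewrite derive_mx//; apply/matrixP => i j; rewrite !mxE.
rewrite (_ : (fun s => _) = if j == 0 then a else b); first by case: ifP.
by apply/funext => s; rewrite mxE; case: ifP.
Qed.

(** The geodesic with initial point [(m0, g0)] and initial velocity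
    [g0 om (al, be)], where [(al, be)] is a unit vector.  One formula covers the
    points ([om = 0]) and, for [om] nonzero, the vertical lines ([al = 0]) and the
    semicircles centred on the boundary ([al] nonzero). *)
Section curve.
Variables (m0 g0 al be om : R).
Hypotheses (g0_gt0 : 0 < g0) (albe : al ^+ 2 + be ^+ 2 = 1).

(* [D = cosh (om t) - be sinh (om t)], [om * E = D'] and [S = sinh (om t)]. *)
Let e t := expR (om * t).
Let e' t := expR (- (om * t)).
Let D t := ((1 - be) * e t + (1 + be) * e' t) / 2.
Let E t := ((1 - be) * e t - (1 + be) * e' t) / 2.
Let S t := (e t - e' t) / 2.

Definition hp_geodesic (t : R) : 'rV[R]_2 := hp_point (m0 + g0 * al * S t / D t) (g0 / D t).

Let ee' t : e t * e' t = 1.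
Proof. by rewrite /e /e' -expRD subrr expR0. Qed.

Let de (t : R) : is_derive t 1 e (om * e t).
Proof. by apply: is_derive_eq; rewrite /GRing.scale/= /e; ring. Qed.
Let de' (t : R) : is_derive t 1 e' (- (om * e' t)).
Proof. by apply: is_derive_eq; rewrite /GRing.scale/= /e'; ring. Qed.

Let D_gt0 t : 0 < D t.
Proof.
have e0 : 0 < e t by exact: expR_gt0.
have e0' : 0 < e' t by exact: expR_gt0.
have be1 : -1 <= be <= 1.
  by rewrite -ler_norml -[leRHS]normr1 -ler_sqr ?nnegrE// !real_normK ?num_real// expr1n -albe lerDr sqr_ge0.
have /andP[b1 b2] := be1.
rewrite divr_gt0//.
have [->|bN1] := eqVneq be (- 1).
  by rewrite subrr mul0r addr0 mulr_gt0// opprK.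
by rewrite ltr_wpDl ?mulr_ge0 ?subr_ge0 ?(ltW e0)// mulr_gt0// -ltrBlDl sub0r lt_neqAle eq_sym bN1.
Qed.

Let dD (t : R) : is_derive t 1 D (om * E t).
Proof.
have ? := de t; have ? := de' t.
by apply: is_derive_eq; rewrite /GRing.scale/= /E; field.
Qed.
Let dE (t : R) : is_derive t 1 E (om * D t).
Proof.
have ? := de t; have ? := de' t.
by apply: is_derive_eq; rewrite /GRing.scale/= /D; field.
Qed.
Let ED t : E t ^+ 2 = D t ^+ 2 - al ^+ 2.
Proof.
have := ee' t; rewrite /E /D.
have -> : al ^+ 2 = 1 - be ^+ 2 by rewrite -albe addrK.
move: (e t) (e' t) => x y xy.
have -> : 1 - be ^+ 2 = (1 - be ^+ 2) * (x * y) by rewrite xy mulr1.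
by field.
Qed.

Let dmu (t : R) : is_derive t 1 (fun t => m0 + g0 * al * S t / D t) (g0 * al * om / D t ^+ 2).
Proof.
have DN0 : D t != 0 by rewrite gt_eqF.
have dS : is_derive t 1 S (om * ((e t + e' t) / 2)).
  have ? := de t; have ? := de' t.
  by apply: is_derive_eq; rewrite /GRing.scale/=; field.
have dD' := dD t.
(* The Wronskian of [S] and [D], divided by [om], is constant. *)
have W : (e t + e' t) / 2 * D t = 1 + S t * E t.
  by rewrite -[in RHS](ee' t) /S /D /E; field.
apply: is_derive_eq; rewrite /GRing.scale/= add0r mul1r.
have -> : (D t)^-1 * (g0 * al * (om * ((e t + e' t) / 2))) =
    g0 * al * om * ((e t + e' t) / 2 * D t) / D t ^+ 2 by field.
by rewrite W; field.
Qed.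

Let dga (t : R) : is_derive t 1 (fun t => g0 / D t) (- g0 * om * E t / D t ^+ 2).
Proof.
have DN0 : D t != 0 by rewrite gt_eqF.
have dD' := dD t.
apply: is_derive_eq; rewrite /GRing.scale/=.
by field.
Qed.

Let ddmu (t : R) : is_derive t 1 (fun t => g0 * al * om / D t ^+ 2)
  (- 2 * g0 * al * om ^+ 2 * E t / D t ^+ 3).
Proof.
have DN0 : D t != 0 by rewrite gt_eqF.
have D2N0 : D t ^+ 2 != 0 by rewrite expf_neq0.
have dD' := dD t.
by apply: is_derive_eq; rewrite /GRing.scale/=; field.
Qed.

Let ddga (t : R) : is_derive t 1 (fun t => - g0 * om * E t / D t ^+ 2)
  (- g0 * om ^+ 2 * (D t ^+ 2 - 2 * E t ^+ 2) / D t ^+ 3).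
Proof.
have DN0 : D t != 0 by rewrite gt_eqF.
have D2N0 : D t ^+ 2 != 0 by rewrite expf_neq0.
have dD' := dD t; have dE' := dE t.
by apply: is_derive_eq; rewrite /GRing.scale/=; field.
Qed.

Let velocity t := hp_point (g0 * al * om / D t ^+ 2) (- g0 * om * E t / D t ^+ 2).

Let dc (t : R) : is_derive t 1 hp_geodesic (velocity t).
Proof. exact: is_derive_hp_point. Qed.

Let derive1_c : derive1 hp_geodesic = velocity.
Proof. by apply/funext => t; rewrite derive1E; have ? := dc t; exact: derive_val. Qed.

Let dv (t : R) : is_derive t 1 velocity
  (hp_point (- 2 * g0 * al * om ^+ 2 * E t / D t ^+ 3)
            (- g0 * om ^+ 2 * (D t ^+ 2 - 2 * E t ^+ 2) / D t ^+ 3)).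
Proof. exact: is_derive_hp_point. Qed.

Lemma hp_geodesic0 : hp_geodesic 0 = hp_point m0 g0.
Proof.
rewrite /hp_geodesic /D /S /e /e' mulr0 oppr0 expR0 subrr mul0r mulr0 mul0r addr0.
by congr hp_point; field; apply/eqP; lra.
Qed.

Lemma hp_geodesic_velocity0 :
  derive1 hp_geodesic 0 = hp_point (g0 * al * om) (g0 * be * om).
Proof.
rewrite derive1_c /velocity /D /E /e /e' mulr0 oppr0 expR0.
have -> : ((1 - be) * 1 + (1 + be) * 1) / 2 = 1 by field.
by congr hp_point; rewrite expr1n divr1//; field.
Qed.

Variable g : 'rV[R]_2 -> 'M[R]_2.
Hypothesis gE : forall z, half_plane z -> g z = (2 * z 0 1 ^+ 2)^-1%:M.

Let hp_c t : half_plane (hp_geodesic t).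
Proof. by rewrite /half_plane /= mxE/= divr_gt0. Qed.

Lemma hp_geodesic_geodesic : geodesic half_plane g hp_geodesic.
Proof.
split; first exact: hp_c.
  move=> t; rewrite derive1_c; split.
    by have [] := dc t.
  by have [] := dv t.
move=> t k; rewrite derive1_c.
have -> : derive1 velocity t = hp_point (- 2 * g0 * al * om ^+ 2 * E t / D t ^+ 3)
            (- g0 * om ^+ 2 * (D t ^+ 2 - 2 * E t ^+ 2) / D t ^+ 3).
  by rewrite derive1E; have ? := dv t; exact: derive_val.
rewrite !big_ord_recl !big_ord0 !(christoffelE gE)// /hp_christoffel.
have DN0 : D t != 0 by rewrite gt_eqF.
have gN0 : g0 != 0 by rewrite gt_eqF.
case: (ord2P k) => ->; rewrite !mxE/=.
  by field; rewrite ?gN0 ?DN0.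
(* The second geodesic equation reduces to [al ^+ 2 + E ^+ 2 = D ^+ 2], which
   also gives the constant speed. *)
set lhs := LHS.
have -> : lhs = g0 * om ^+ 2 / D t ^+ 3 * (al ^+ 2 - (D t ^+ 2 - E t ^+ 2)).
  by rewrite /lhs; field; rewrite ?gN0 ?DN0.
by rewrite ED; ring.
Qed.

(** The squared Euclidean speed over [gamma ^+ 2] is
    [om^2 (al^2 + E^2) / D^2 = om^2]. *)
Lemma hp_geodesic_speed t : speed g hp_geodesic t = `|om| / Num.sqrt 2.
Proof.
rewrite /speed derive1_c (inner_scalar _ (gE (hp_c t))) !mxE/=.
have DN0 : D t != 0 by rewrite gt_eqF.
have gN0 : g0 != 0 by rewrite gt_eqF.
set q := (X in Num.sqrt X).
have -> : q = om ^+ 2 * ((al ^+ 2 + E t ^+ 2) / D t ^+ 2) / 2.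
  by rewrite /q; field; rewrite ?gN0 ?DN0.
rewrite ED addrC subrK divff ?expf_neq0// mulr1.
by rewrite sqrtrM ?sqr_ge0// sqrtr_sqr sqrtrV.
Qed.
End curve.

Lemma polar_form (a b : R) :
  exists al be om : R, [/\ al ^+ 2 + be ^+ 2 = 1, a = om * al & b = om * be].
Proof.
pose om := Num.sqrt (a ^+ 2 + b ^+ 2).
have ab0 : 0 <= a ^+ 2 + b ^+ 2 by rewrite addr_ge0 ?sqr_ge0.
have om2 : om ^+ 2 = a ^+ 2 + b ^+ 2 by rewrite sqr_sqrtr.
have [om0|omN0] := eqVneq om 0.
  exists 1, 0, 0; rewrite !mul0r expr1n expr0n addr0.
  move/eqP: om2; rewrite om0 expr0n eq_sym paddr_eq0 ?sqr_ge0// !sqrf_eq0.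
  by move=> /andP[/eqP-> /eqP->].
exists (a / om), (b / om), om; split; last 2 first.
- by rewrite mulrCA divff// mulr1.
- by rewrite mulrCA divff// mulr1.
by rewrite !expr_div_n -mulrDl -om2 divff// expf_neq0.
Qed.

Lemma hp_point_eta (z : 'rV[R]_2) : z = hp_point (z 0 0) (z 0 1).
Proof. by apply/rowP => j; rewrite mxE; case: (ord2P j) => ->. Qed.

(** Polar coordinates for [v / gamma] give the parameters of the geodesic. *)
Lemma metric_complete (g : 'rV[R]_2 -> 'M[R]_2) :
  (forall z, half_plane z -> g z = (2 * z 0 1 ^+ 2)^-1%:M) ->
  geodesically_complete half_plane g.
Proof.
move=> gE theta v t0; have tN0 : theta 0 1 != 0 by rewrite gt_eqF.
have [al [be [om [albe vE0 vE1]]]] := polar_form (v 0 0 / theta 0 1) (v 0 1 / theta 0 1).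
exists (hp_geodesic (theta 0 0) (theta 0 1) al be om); split.
- exact: hp_geodesic_geodesic.
- by rewrite hp_geodesic0 -hp_point_eta.
- rewrite hp_geodesic_velocity0// (hp_point_eta v); congr hp_point.
  + by rewrite -mulrA (mulrC al) -vE0 mulrC divfK.
  + by rewrite -mulrA (mulrC be) -vE1 mulrC divfK.
Qed.

Lemma vertical_geodesic (m gamma t : R) :
  hp_geodesic m gamma 0 (-1) 1 t = hp_point m (gamma * expR (- t)).
Proof.
rewrite /hp_geodesic !mul1r; congr hp_point; first by rewrite mulr0 !mul0r addr0.
rewrite opprK subrr mul0r addr0 expRN; have := expR_gt0 t.
by move: (expR t) => y y0; field; rewrite gt_eqF.
Qed.

End half_plane_geometry.

(** * Exact solution, entropy and geometry of the Cauchy family *)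

Theorem theorem11 (R : realType) :
  (* invariance: the solution issued from Cauchy(m, gamma), on any time
     interval containing 0, exists, is unique, and is Cauchy(m, gamma e^-t) *)
  (forall (m gamma : R) (J : set R) (f : R -> R -> R),
     0 < gamma -> is_interval J -> J 0 ->
     (flow_solution J f /\ f 0 = cauchy_density m gamma) <->
     (forall t, J t -> f t = cauchy_density m (gamma * expR (- t)))) /\
  (* reduced dynamics *)
  (forall (J : set R) (m gamma : R -> R),
     is_interval J -> (forall t, J t -> 0 < gamma t) ->
     flow_solution J (fun t => cauchy_density (m t) (gamma t)) <->
     (forall t, J t -> has_deriv_within J m t 0 /\
                       has_deriv_within J gamma t (- gamma t))) /\
  (* entropy law *)
  (forall m gamma : R, 0 < gamma ->
     entropy (cauchy_density m gamma) = (ln (4 * pi * gamma))%:E) /\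
  (forall (m gamma : R) (J : set R) (f : R -> R -> R),
     0 < gamma -> is_interval J -> J 0 ->
     flow_solution J f -> f 0 = cauchy_density m gamma ->
     forall t, J t ->
       entropy (f t) = (ln (4 * pi * (gamma * expR (- t))))%:E /\
       has_deriv_within J (fun s => fine (entropy (f s))) t (- 1)) /\
  (* Fisher-Rao metric *)
  (forall theta : 'rV[R]_2, half_plane theta ->
     fisher_regular cauchy_family theta /\
     forall u : 'rV[R]_2,
       inner (fisher_metric cauchy_family) theta u u =
       (u 0 0 ^+ 2 + u 0 1 ^+ 2) / (2 * theta 0 1 ^+ 2)) /\
  hyperbolic_plane (- 2 : R) (fisher_metric cauchy_family) /\
  (* the flow traces the vertical geodesics at constant speed *)
  (forall m gamma : R, 0 < gamma ->
     let c := fun t : R => hp_point m (gamma * expR (- t)) in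
     [/\ flow_solution setT (fun t => cauchy_family (c t)),
         geodesic half_plane (fisher_metric cauchy_family) c,
         range c = [set theta : 'rV[R]_2 | theta 0 0 = m /\ 0 < theta 0 1] &
         forall t, speed (fisher_metric cauchy_family) c t = 1 / Num.sqrt 2]).
Proof.
have metricE z : half_plane z ->
    fisher_metric cauchy_family z = (2 * z 0 1 ^+ 2)^-1%:M :> 'M[R]_2.
  exact: cauchy_fisher_metric.
split; first exact: cauchy_flow_iff.
split; first exact: cauchy_reduced_dynamics.
split; first exact: cauchy_entropy.
split.
  move=> m gamma J f g0 iJ J0 sf f0.
  exact/(cauchy_flow_entropy g0)/(cauchy_flow_iff m f g0 iJ J0).
split.
  move=> theta t0; split=> [|u]; first exact: cauchy_fisher_regular.
  by rewrite (inner_scalar u (metricE theta t0)) mulrC.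
split.
  split; first by rewrite oppr_lt0.
  - exact: metric_riemannian metricE.
  - exact: metric_complete metricE.
  - by move=> theta; exact: (metric_gauss_curvature metricE).
move=> m gamma g0 c.
have cE : c = hp_geodesic m gamma 0 (-1) 1.
  by apply/funext => t; rewrite vertical_geodesic.
have unit : 0 ^+ 2 + (-1) ^+ 2 = 1 :> R by rewrite expr0n add0r sqrrN expr1n.
split.
- apply: flow_solution_eq (cauchy_flow_solution setT m g0) => t _.
  by rewrite /cauchy_family !mxE.
- by rewrite cE; apply: hp_geodesic_geodesic metricE.
- apply/seteqP; split => [_ [t _ <-]|theta [tm t0]].
    by rewrite /= !mxE/= mulr_gt0 ?expR_gt0.
  exists (- ln (theta 0 1 / gamma)) => //.
  rewrite /c opprK lnK ?posrE ?divr_gt0// mulrC divfK ?gt_eqF//.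
  by rewrite -tm -hp_point_eta.
- by move=> t; rewrite cE (hp_geodesic_speed _ _ _ _ metricE)// normr1.
Qed.
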